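(* Let $v_1,\ldots,v_m\in\mathbb{N}^s$, $\mathcal{P}=\mathrm{conv}(v_1,\ldots,v_m)$, and let $w=w_1\cdots w_p$ be any monomial of degree $p\ge 1$ in $t_1,\ldots,t_s$, with $w_i\in\{t_1,\ldots,t_s\}$ for $i=1,\ldots,p$. If $w_i\not\equiv0$ on $\mathcal{P}$ for $i=1,\ldots,p$, then $E_{\mathcal{P}}^{s,w}$ is a polynomial whose leading coefficient is the relative volume $\mathrm{vol}(\mathcal{P}_w)$ of $\mathcal{P}_w$ and $$\deg(E_{\mathcal{P}}^{s,w})=\dim(\mathcal{P})+p.$$
   Context: $\mathbb{N}=\{0,1,2,\ldots\}$. Each variable $t_i$ is viewed as the $i$-th coordinate function on $\mathbb{R}^s$. $E_{\mathcal{P}}^{s,w}(n)=\sum_{a\in n\mathcal{P}\cap\mathbb{Z}^s}w(a)$, where $w(a)=w_1(a)\cdots w_p(a)$ (superscript $s$ names the weighting). The $r$-weight lifting polytope is $\mathcal{P}_w=\mathrm{conv}(\mathcal{G})\subset\mathbb{R}^{s+p}$, where $\mathcal{G}=\{(v_i,0)+w_{j_1}(v_i)e_{s+j_1}+\cdots+w_{j_k}(v_i)e_{s+j_k}\mid1\le i\le m,\ 1\le j_1<\cdots<j_k\le p\}$, with $k=0$ allowed (giving $(v_i,0)\in\mathcal{G}$), and $e_j$ are unit vectors. The relative volume of a lattice polytope $\mathcal{Q}\subset\mathbb{R}^N$ is its volume within its affine span, normalized so that a fundamental domain of the lattice $\mathrm{aff}(\mathcal{Q})\cap\mathbb{Z}^N$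 has volume $1$. *)

(* Defs.v *)
From HB Require Import structures.
From mathcomp Require Import all_boot all_order all_algebra.
From mathcomp Require Import all_classical all_reals all_analysis.

Set Implicit Arguments.
Unset Strict Implicit.
Unset Printing Implicit Defensive.

Import Order.TTheory GRing.Theory Num.Theory.
Import numFieldNormedType.Exports.

Local Open Scope classical_set_scope.
Local Open Scope ring_scope.

Section Hulls.
Variables (R : realType) (V : lmodType R).
Implicit Types A : set V.

Definition affine_hull A : set V :=
  [set x | exists k (y : 'I_k -> V) (c : 'I_k -> R),
    [/\ forall i, A (y i), \sum_i c i = 1 & x = \sum_i c i *: y i]].

Definition convex_hull A : set V :=
  [set x | exists k (y : 'I_k -> V) (c : 'I_k -> R),
    [/\ forall i, A (y i), forall i, 0 <= c i, \sum_i c i = 1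
      & x = \sum_i c i *: y i]].

Definition dilate (n : nat) A : set V := [set n%:R *: x | x in A].

End Hulls.

(* The dimension of the affine span of A (0 by convention if A is empty). *)
Definition affine_dim (R : realType) (N : nat) (A : set 'rV[R]_N) : nat :=
  get [set d | exists (x0 : 'rV[R]_N) (B : 'M[R]_(d, N)),
    row_free B /\ affine_hull A = [set x0 + u *m B | u in [set: 'rV[R]_d]]].

(* Lebesgue measure on R^n, as the n-fold product of the Lebesgue measure on R.
   The library has no such measure on row vectors, so it is built on the
   iterated product R * (R * (... * unit)) and transported by [row_of_iter]. *)
Fixpoint iter_display (R : realType) (n : nat) : measure_display :=
  if n is k.+1 then
    ((R.-ocitv.-measurable).-sigma, iter_display R k).-prod%mdisp
  else default_measure_display.

Fixpoint iterR (R : realType) (n : nat) : measurableType (iter_display R n) :=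
  match n return measurableType (iter_display R n) with
  | 0%N => unit : measurableType _
  | k.+1 => (measurableTypeR R * iterR R k)%type : measurableType _
  end.

Fixpoint iter_lebesgue (R : realType) (n : nat) :
    set (iterR R n) -> \bar R :=
  match n return set (iterR R n) -> \bar R with
  | 0%N => \d_(tt : unit)
  | k.+1 => (@lebesgue_measure R \x @iter_lebesgue R k)%E
  end.

Fixpoint row_of_iter (R : realType) (n : nat) : iterR R n -> 'rV[R]_n :=
  match n return iterR R n -> 'rV[R]_n with
  | 0%N => fun _ => 0
  | k.+1 => fun x => row_mx (x.1)%:M (row_of_iter x.2) : 'rV[R]_(1 + k)
  end.

Definition volume (R : realType) (n : nat) (A : set 'rV[R]_n) : \bar R :=
  iter_lebesgue (@row_of_iter R n @^-1` A).

Definition integer_points (R : realType) (N : nat) : set 'rV[R]_N :=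
  range (map_mx intr : 'rV[int]_N -> 'rV[R]_N).
Arguments integer_points R N : clear implicits.

(* x0 + Z^d B is the lattice of integer points of aff(Q), and R^d B is the
   direction space of aff(Q). *)
Definition lattice_frame (R : realType) (N d : nat) (Q : set 'rV[R]_N)
    (x0 : 'rV[R]_N) (B : 'M[R]_(d, N)) : Prop :=
  [/\ row_free B,
      affine_hull Q = [set x0 + u *m B | u in [set: 'rV[R]_d]] &
      affine_hull Q `&` integer_points R N =
        [set x0 + u *m B | u in integer_points R d]].

(* In the coordinates of a lattice frame, the unit cube is a fundamental domain
   of the lattice, so the normalized volume on aff(Q) is Lebesgue measure.  The
   value does not depend on the frame, as two frames of Q differ by an affine
   unimodular change of coordinates. *)
Definition relative_volume (R : realType) (N : nat) (Q : set 'rV[R]_N) :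
    \bar R :=
  get [set r | exists (d : nat) (x0 : 'rV[R]_N) (B : 'M[R]_(d, N)),
    lattice_frame Q x0 B /\ r = volume [set u : 'rV[R]_d | Q (x0 + u *m B)]].

Definition polytope (R : realType) (s m : nat) (v : 'I_m -> 'rV[nat]_s) :
    set 'rV[R]_s :=
  convex_hull (range (fun i => map_mx (fun n => n%:R) (v i))).
Arguments polytope R {s m} v.

Definition coordinate (R : realType) (s : nat) (i : 'I_s) : 'rV[R]_s -> R :=
  fun x => x ord0 i.

(* E_P^{s,w}(n), for the weight w = w_1 ... w_p. *)
Definition weighted_ehrhart (R : realType) (s p : nat) (P : set 'rV[R]_s)
    (w : 'I_p -> 'rV[R]_s -> R) (n : nat) : R :=
  \sum_(a \in dilate n P `&` integer_points R s) \prod_(j < p) w j a.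

(* The index set {j_1 < ... < j_k} is J. *)
Definition lifting_points (R : realType) (s p m : nat) (v : 'I_m -> 'rV[nat]_s)
    (w : 'I_p -> 'rV[R]_s -> R) : set 'rV[R]_(s + p) :=
  [set g | exists (i : 'I_m) (J : {set 'I_p}),
    let vi := map_mx (fun n => n%:R) (v i) in
    g = row_mx vi 0 + \sum_(j in J) w j vi *: delta_mx ord0 (rshift s j)].

Definition lifting_polytope (R : realType) (s p m : nat)
    (v : 'I_m -> 'rV[nat]_s) (w : 'I_p -> 'rV[R]_s -> R) :
    set 'rV[R]_(s + p) :=
  convex_hull (lifting_points v w).

(* Main.v *)
Require Import Defs.
From HB Require Import structures.
From mathcomp Require Import all_boot all_order all_algebra.
From mathcomp Require Import all_classical all_reals all_analysis.
From mathcomp Require Import ring.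
From mathcomp Require polyrcf.

(** Polynomiality.  Homogenize: a lattice point [a] of [nP] is [sum x_i v_i] with
[x >= 0] and [sum x_i = n], and among these representations the
lexicographically largest is unique.  Whether [x] is the largest depends only on
its support [S], and such an [S] is affinely independent, so the cone over [P]
is a disjoint union of relatively open simplicial cones.  On each of them the
coordinates [x_i] have bounded denominators; writing [x_i = c_i - f_i] with
[c_i] the ceiling, the weighted count is, for each of finitely many [f], a
convolution of polynomials over the [c_i >= 1] with prescribed sum.  Such a
convolution is polynomial in the sum; the value at [0] could differ, but the
difference is a product of values at [0] that contains a factor [0] as
[p >= 1].

Degree and leading coefficient.  [E n] also counts the lattice points [(a, b)]
of [n P_w] with [b_j < w_j a].  In the coordinates of a lattice frame of [P_w],
of dimension [N], the region [K] of [P_w] satisfies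
[E (n - c) <= n^N vol K <= E (n + c)], because for some [c] the dilate [c P_w]
contains a translate of the unit cube by a lattice vector: adding this vector
moves the cubes of the grid that meet [n P_w] into [(n + c) P_w].  Hence
[E] has degree [N] and leading coefficient [vol K] for any frame.  Finally
[aff P_w] is [aff P] times [R^p], so [N = dim P + p]. *)

Set Implicit Arguments.
Unset Strict Implicit.
Unset Printing Implicit Defensive.

Import Order.TTheory GRing.Theory Num.Theory.

Local Open Scope classical_set_scope.
Local Open Scope ring_scope.

(** * Polynomial sequences *)

Definition polyfun (R : numFieldType) (f : nat -> R) : Prop :=
  exists q : {poly R}, forall n, f n = q.[n%:R].

Section PolyFun.
Variable R : numFieldType.
Implicit Types (f g : nat -> R) (p q : {poly R}).

Lemma eq_polyfun f g : f =1 g -> polyfun f -> polyfun g.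
Proof. by move=> fg [q qE]; exists q => n; rewrite -fg. Qed.

Lemma polyfunD f g : polyfun f -> polyfun g -> polyfun (fun n => f n + g n).
Proof. by move=> [p pE] [q qE]; exists (p + q) => n; rewrite hornerD pE qE. Qed.

Lemma polyfunM f g : polyfun f -> polyfun g -> polyfun (fun n => f n * g n).
Proof. by move=> [p pE] [q qE]; exists (p * q) => n; rewrite hornerM pE qE. Qed.

Lemma polyfunC (a : R) : polyfun (fun=> a).
Proof. by exists a%:P => n; rewrite hornerC. Qed.

Lemma polyfun_sum (I : Type) (r : seq I) (P : pred I) (F : I -> nat -> R) :
  (forall i, P i -> polyfun (F i)) -> polyfun (fun n => \sum_(i <- r | P i) F i n).
Proof.
move=> FP; elim: r => [|i r IH].
  by apply: eq_polyfun (polyfunC 0) => n; rewrite big_nil.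
have [Pi|Pi] := boolP (P i); last first.
  by apply: eq_polyfun IH => n; rewrite big_cons (negPf Pi).
by apply: eq_polyfun (polyfunD (FP i Pi) IH) => n; rewrite big_cons Pi.
Qed.

(** Telescoping [(c + 1) ^+ k.+1 - c ^+ k.+1] and the binomial formula express [n ^+ k.+1] by the
    power sums of exponent at most [k]; the one of exponent [k] has the coefficient [k + 1] and is
    solved for. *)
Lemma polyfun_psumX k : polyfun (fun n => \sum_(c < n) (c%:R : R) ^+ k).
Proof.
have [K] := ubnP k; elim: K k => // K IH k; rewrite ltnS => kK.
pose L n : R := n%:R ^+ k.+1 -
  \sum_(i < k) ('C(k.+1, i)%:R * \sum_(c < n) (c%:R : R) ^+ i).
have LP : polyfun L.
  apply: polyfunD.
    by exists 'X^(k.+1) => n; rewrite hornerXn.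
  apply: (@eq_polyfun (fun n => (-1) *
      \sum_(i < k) ('C(k.+1, i)%:R * \sum_(c < n) (c%:R : R) ^+ i))).
    by move=> n; rewrite mulN1r.
  apply: polyfunM; first exact: polyfunC.
  apply: polyfun_sum => i _; apply: polyfunM; first exact: polyfunC.
  by apply: IH; apply: leq_trans kK.
apply: (@eq_polyfun (fun n => k.+1%:R^-1 * L n)); last first.
  by apply: polyfunM => //; exact: polyfunC.
move=> n; apply: (canLR (mulKf _)); first by rewrite pnatr_eq0.
apply/eqP; rewrite /L subr_eq; apply/eqP.
under [X in _ + X]eq_bigr do rewrite big_distrr.
rewrite exchange_big /= big_distrr -big_split /=.
elim: n => [|n IHn]; first by rewrite big_ord0 expr0n.
rewrite big_ord_recr /= -IHn -natr1 [n%:R + 1]addrC exprDn.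
rewrite (eq_bigr (fun i : 'I_k.+2 => 'C(k.+1, i)%:R * (n%:R : R) ^+ i)); last first.
  by move=> i _; rewrite expr1n mul1r mulr_natl.
rewrite 2!big_ord_recr /= binn binSn mul1r [LHS]addrC; congr (_ + _).
by rewrite addrC.
Qed.

Lemma polyfun_psum p : polyfun (fun n => \sum_(c < n) p.[c%:R]).
Proof.
apply: (@eq_polyfun (fun n => \sum_(i < size p) p`_i * \sum_(c < n) c%:R ^+ i)).
  move=> n; under eq_bigr do rewrite big_distrr.
  rewrite exchange_big; apply: eq_bigr => c _ /=.
  by rewrite horner_coef.
apply: polyfun_sum => i _; apply: polyfunM; first exact: polyfunC.
exact: polyfun_psumX.
Qed.

(** Expanding [q.[n - c]] binomially separates [n] from [c]: powers of [n] times sums of polynomials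
    in [c]. *)
Lemma polyfun_conv p q :
  polyfun (fun n => \sum_(c < n) p.[c%:R] * q.[n%:R - c%:R]).
Proof.
apply: (@eq_polyfun (fun n => \sum_(k < size q) \sum_(i < k.+1)
   q`_k * 'C(k, i)%:R * (n%:R ^+ (k - i)) *
   \sum_(c < n) (p * (- 'X) ^+ i).[c%:R])).
  move=> n.
  under eq_bigr do under eq_bigr do rewrite big_distrr.
  under eq_bigr do rewrite exchange_big.
  rewrite exchange_big; apply: eq_bigr => c _ /=.
  rewrite (horner_coef q) big_distrr; apply: eq_bigr => k _ /=.
  rewrite exprDn 2!big_distrr /=; apply: eq_bigr => i _ /=.
  rewrite hornerM horner_exp hornerN hornerX -mulr_natl.
  by ring.
apply: polyfun_sum => k _; apply: polyfun_sum => i _.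
apply: polyfunM; last exact: polyfun_psum.
apply: polyfunM; first exact: polyfunC.
by exists 'X^(k - i) => n; rewrite hornerXn.
Qed.

(** The term at [c = 0] is removed from the full convolution. At [n = 0] that convolution is empty,
    so only the removed term is left; this value is recorded because later sums may have total
    [0]. *)
Lemma conv_poly p q : exists r : {poly R},
  (forall n, (0 < n)%N ->
     r.[n%:R] = \sum_(1 <= c < n) p.[c%:R] * q.[(n - c)%:R]) /\
  r.[0] = - (p.[0] * q.[0]).
Proof.
have [r rE] := polyfun_conv p q.
exists (r - p.[0] *: q); split => [[//|n] _|]; rewrite hornerD hornerN hornerZ.
  rewrite -rE big_ord_recl /= subr0 addrAC subrr add0r.
  rewrite big_add1 big_mkord; apply: eq_bigr => c _.
  by rewrite /bump /= add1n natrB// ltnS ltnW.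
by have := rE 0; rewrite big_ord0 => <-; rewrite sub0r.
Qed.

End PolyFun.

(** * Sums over tuples with prescribed support and total *)

Section SupportedSum.
Variables (R : numFieldType) (I : finType) (b : I -> {poly R}).

(** Generating polynomial of the values at positive arguments: products of these compute
    convolutions, and truncation at [M] leaves the coefficients below [M] unchanged. *)
Let T M i : {poly R} := \poly_(c < M) (if c == 0 then 0 else (b i).[c%:R]).

(** Induction with [conv_poly]: the vanishing constant coefficients restrict the coefficient of a
    product to [1 <= c < n]. Each factor after the first changes the sign of the value at [0]. *)
Lemma coef_prod_positive_series (s : seq I) : s != [::] ->
  exists r : {poly R},
  [/\ forall M, (\prod_(i <- s) T M i)`_0 = 0,
      forall M n, (0 < n < M)%N -> (\prod_(i <- s) T M i)`_n = r.[n%:R] &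
      r.[0] = (-1) ^+ (size s).-1 * \prod_(i <- s) (b i).[0]].
Proof.
elim: s => // i [_ _|j s /(_ isT)[r [r0 rE rP]] _].
  exists (b i); split => [M|M n /andP[n0 nM]|].
  - by rewrite big_seq1 coef_poly; case: ifP.
  - by rewrite big_seq1 coef_poly nM gtn_eqF.
  - by rewrite big_seq1 expr0 mul1r.
have [q [qE q0]] := conv_poly (b i) r.
exists q; split => [M|M n /andP[n0 nM]|].
- by rewrite big_cons coef0M r0 mulr0.
- rewrite big_cons coefM qE//.
  case: n n0 nM qE => // n _ nM _.
  rewrite big_ord_recl {1}/T coef_poly /= if_same mul0r add0r.
  rewrite big_ord_recr /= /bump /= add1n subSS subnn r0 mulr0 addr0.
  rewrite big_add1 big_mkord; apply: eq_bigr => c _.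
  rewrite add1n coef_poly /= ifT; last by rewrite (leq_trans _ nM)// !ltnS ltnW.
  rewrite rE// subn_gt0 ltnS ltn_ord /=.
  by rewrite (leq_ltn_trans _ nM)// leq_subr.
- by rewrite q0 rP [in RHS]big_cons /= exprS mulN1r mulNr mulrCA.
Qed.

(* For [n = 0] the sum is empty, while the polynomial takes the value
   [+/- prod_i (b i).[0]]. *)
Lemma supported_sum_poly (S : {set I}) : S != finset.set0 ->
  exists r : {poly R}, forall M n, (n < M)%N ->
    (0 < n)%N \/ \prod_i (b i).[0] = 0 ->
    \sum_(f : {ffun I -> 'I_M} |
        [forall i, (f i != 0 :> nat) == (i \in S)] && (\sum_i f i == n)%N)
      \prod_i (b i).[(f i)%:R] = r.[n%:R].
Proof.
move=> S0.
have [r [r0 rE rP]] : exists r : {poly R},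
  [/\ forall M, (\prod_(i in S) T M i)`_0 = 0,
      forall M n, (0 < n < M)%N -> (\prod_(i in S) T M i)`_n = r.[n%:R] &
      r.[0] = (-1) ^+ #|S|.-1 * \prod_(i in S) (b i).[0]].
  have := @coef_prod_positive_series (enum S).
  rewrite -size_eq0 -cardE cards_eq0 => /(_ S0)[r [r0 rE rP]].
  exists r; split => [M|M n nM|]; by rewrite -big_enum ?r0 ?rE.
exists ((\prod_(i in ~: S) (b i).[0]) *: r) => M n nM n0.
(* [t] builds the support condition into the factors: outside [S] only the constant term survives,
   inside [S] only positive exponents. *)
pose t (i : I) (k : 'I_M) : R :=
  if (k != 0 :> nat) == (i \in S) then (b i).[k%:R] else 0.
have prodE : \prod_i (\sum_(k < M) t i k *: 'X^k) =
   (\prod_(i in ~: S) (b i).[0]) *: \prod_(i in S) T M i.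
  rewrite (bigID (mem S)) /= mulrC -mul_polyC; congr (_ * _).
    rewrite rmorph_prod /=; apply: eq_big => [i|i iS]; first by rewrite inE.
    case: M nM @t => // M _ t; rewrite big_ord_recl big1 ?addr0.
      by rewrite /t /= (negPf iS) expr0 -[RHS]alg_polyC.
    by move=> k _; rewrite /t /= (negPf iS) scale0r.
  apply: eq_bigr => i iS; rewrite /T poly_def; apply: eq_bigr => k _.
  by rewrite /t iS eqb_id; case: (k : nat).
transitivity ((\prod_i (\sum_(k < M) t i k *: 'X^k))`_n); last first.
  rewrite prodE coefZ hornerZ; case: n => [|n] in nM n0 *; last by rewrite rE.
  case: n0 => // n0; rewrite r0 rP mulr0 mulrCA.
  suff -> : \prod_(i in ~: S) (b i).[0] * \prod_(i in S) (b i).[0] = 0 by rewrite mulr0.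
  rewrite -[RHS]n0 [in RHS](bigID (mem S)) mulrC /=; congr (_ * _).
  by apply: eq_bigl => i; rewrite inE.
rewrite bigA_distr_bigA coef_sum /= big_mkcond; apply: eq_bigr => f _.
rewrite scaler_prod -expr_sum coefZ coefXn [n == _]eq_sym.
case: eqP => _; last by rewrite andbF mulr0.
rewrite andbT mulr1; case: ifP => [/forallP fS|/forallP fS].
  by apply: eq_bigr => i _; rewrite /t fS.
have /existsP[i iS] : [exists i, ~~ ((f i != 0 :> nat) == (i \in S))].
  by rewrite -negb_forall; apply/forallP.
by rewrite (bigD1 i) //= /t (negPf iS) mul0r.
Qed.

End SupportedSum.

(** * Lexicographically maximal representations *)

Definition vsupp (R : nmodType) m (x : 'rV[R]_m) : {set 'I_m} :=
  [set i | x ord0 i != 0].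

Section Lexpos.
Variables (R : realFieldType) (m : nat).
Implicit Types x y z : 'rV[R]_m.

Definition lexpos x : bool :=
  [exists i, (0 < x ord0 i) && [forall j : 'I_m, (j < i)%N ==> (x ord0 j == 0)]].

Lemma lexposP x :
  reflect (exists2 i, 0 < x ord0 i & forall j : 'I_m, (j < i)%N -> x ord0 j = 0)
          (lexpos x).
Proof.
apply: (iffP existsP) => [[i /andP[i0 /forallP ij]]|[i i0 ij]].
  by exists i => // j ji; apply/eqP; have := ij j; rewrite ji.
exists i; rewrite i0; apply/forallP => j; apply/implyP => /ij ->.
exact: eqxx.
Qed.

Lemma lexposD x y : lexpos x -> lexpos y -> lexpos (x + y).
Proof.
move=> /lexposP[i xi xj] /lexposP[k yk yj]; apply/lexposP.
case: (ltngtP i k) => ik.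
- exists i => [|j ji]; rewrite mxE; first by rewrite yj// addr0.
  by rewrite xj// yj ?addr0// (ltn_trans ji).
- exists k => [|j ji]; rewrite mxE; first by rewrite xj// add0r.
  by rewrite yj// xj ?addr0// (ltn_trans ji).
- have {}ik : i = k by exact: val_inj.
  subst k; exists i => [|j ji]; rewrite mxE; first exact: addr_gt0.
  by rewrite xj// yj// addr0.
Qed.

Lemma lexposZ (a : R) x : 0 < a -> lexpos x -> lexpos (a *: x).
Proof.
move=> a0 /lexposP[i xi xj]; apply/lexposP; exists i => [|j ji]; rewrite mxE.
  exact: mulr_gt0.
by rewrite xj// mulr0.
Qed.

Lemma lexpos0 : lexpos 0 = false.
Proof. by apply/lexposP => -[i]; rewrite mxE ltxx. Qed.

Lemma lexposN x : lexpos x -> ~~ lexpos (- x).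
Proof.
by move=> x0; apply/negP => /(lexposD x0); rewrite subrr lexpos0.
Qed.

Lemma lexpos_total x : x != 0 -> lexpos x || lexpos (- x).
Proof.
move=> x0; have [i0 xi0] : exists i, x ord0 i != 0.
  apply/existsP; rewrite -[X in is_true X]negbK negb_exists; apply/negP => /forallP xE.
  case/eqP: x0; apply/rowP => i; rewrite mxE; apply/eqP.
  by rewrite -[_ == _]negbK xE.
case: (@arg_minnP _ i0 (fun i => x ord0 i != 0) val xi0) => i xi imin.
have xj (j : 'I_m) : (j < i)%N -> x ord0 j = 0.
  by move=> ji; apply/eqP; apply/contraT => /imin; rewrite leqNgt ji.
case: (ltgtP (x ord0 i) 0) => xi'; last by rewrite xi' eqxx in xi.
  apply/orP; right; apply/lexposP; exists i => [|j ji]; rewrite mxE ?oppr_gt0//.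
  by rewrite xj// oppr0.
by apply/orP; left; apply/lexposP; exists i.
Qed.

Definition lexle x y := ~~ lexpos (x - y).

Lemma lexle_total : total lexle.
Proof.
move=> x y; rewrite /lexle -[y - x]opprB.
by case: (boolP (lexpos (x - y))) => //= /lexposN.
Qed.

Lemma lexle_trans : transitive lexle.
Proof.
move=> y x z; rewrite /lexle => xy yz; apply/negP => xz.
have [xyE|xyN] := eqVneq (x - y) 0.
  by move: yz; rewrite -(subr0_eq xyE) xz.
have := lexpos_total xyN; rewrite (negPf xy) /= => yx.
by move: yz; have := lexposD yx xz; rewrite opprB addrA subrK => ->.
Qed.

End Lexpos.

Lemma total_max (T : eqType) (r : rel T) (s : seq T) :
  total r -> transitive r -> s != [::] ->
  exists2 x, x \in s & forall y, y \in s -> r y x.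
Proof.
move=> rt rtr; elim: s => // a [|b s] IH _.
  exists a; rewrite ?mem_head// => y; rewrite inE => /eqP ->.
  by have := rt a a; rewrite orbb.
have [x xs xm] := IH isT.
have [ax|xa] := orP (rt a x).
  exists x; first by rewrite inE xs orbT.
  by move=> y; rewrite inE => /orP[/eqP->//|/xm].
exists a; rewrite ?mem_head// => y; rewrite inE => /orP[/eqP->|/xm yx].
  by have := rt a a; rewrite orbb.
exact: rtr yx xa.
Qed.

(** * Supports of lexicographically maximal representations *)

Section GoodSupport.
Variables (R : realFieldType) (m N : nat) (G : 'M[R]_(m, N)).
Implicit Types (x y u : 'rV[R]_m) (S : {set 'I_m}).

(* No move along the kernel out of the relatively open cone over [S] is
   lexicographically increasing: representations with support [S] are the
   lexicographically maximal ones. *)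
Definition lexmax_support S : Prop := forall u,
  u *m G = 0 -> (forall i, i \notin S -> 0 <= u ord0 i) -> ~~ lexpos u.

(** The rows of [G] with index in [S] are linearly independent. *)
Definition free_support S : Prop := forall u,
  u *m G = 0 -> vsupp u \subset S -> u = 0.

(** A kernel vector supported in [S] and its opposite both qualify in [lexmax_support], and one of
    them is lexicographically positive unless the vector is zero. *)
Lemma lexmax_free S : lexmax_support S -> free_support S.
Proof.
move=> gS u uG /fintype.subsetP uS; apply/eqP; apply/contraT => /lexpos_total.
have uS0 i : i \notin S -> u ord0 i = 0.
  by move=> iS; apply/eqP; apply: contraNT iS => ui; apply: uS; rewrite inE.
rewrite (negPf (gS u uG _)) => [|i /uS0 ->//].
rewrite (negPf (gS (- u) _ _))// => [|i /uS0 ui].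
  by rewrite mulNmx uG oppr0.
by rewrite mxE ui oppr0.
Qed.

(** Where [y] vanishes, [x - y] is nonnegative, so [x - y] is not lexicographically positive; by
    symmetry neither is [y - x]. *)
Lemma lexmax_uniq x y : (forall i, 0 <= x ord0 i) -> (forall i, 0 <= y ord0 i) ->
  lexmax_support (vsupp x) -> lexmax_support (vsupp y) ->
  x *m G = y *m G -> x = y.
Proof.
move=> x0 y0 gx gy xy; apply/eqP; rewrite -subr_eq0; apply/contraT => /lexpos_total.
rewrite (negPf (gy (x - y) _ _)) /=; first last.
- by move=> i; rewrite inE negbK !mxE => /eqP ->; rewrite subr0.
- by rewrite mulmxBl xy subrr.
rewrite opprB (negPf (gx (y - x) _ _))//.
- by rewrite mulmxBl xy subrr.
- by move=> i; rewrite inE negbK !mxE => /eqP ->; rewrite subr0.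
Qed.

Hypothesis G_sum : forall u, u *m G = 0 -> \sum_i u ord0 i = 0.

(** While the support is dependent, a kernel vector on it gives a lexicographically increasing move,
    followed until a coordinate vanishes. This happens because the coordinates of a kernel vector
    sum to [0], so one is negative. The support shrinks, and induction applies. *)
Lemma free_reduction x : (forall i, 0 <= x ord0 i) ->
  exists y, [/\ forall i, 0 <= y ord0 i, y *m G = x *m G,
    free_support (vsupp y) & lexle x y].
Proof.
have [k] := ubnP #|vsupp x|; elim: k x => // k IH x; rewrite ltnS => xk x0.
have [fx|] := pselect (free_support (vsupp x)).
  by exists x; split => //; rewrite /lexle subrr lexpos0.
move=> /existsNP[u /not_implyP[uG /not_implyP[ux /eqP u0]]].
wlog up : u uG ux u0 / lexpos u.
  move=> H; have [up|un] := orP (lexpos_total u0); first exact: (H u).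
  apply: (H (- u) _ _ _ un); rewrite ?oppr_eq0// ?mulNmx ?uG ?oppr0//.
  by apply: fintype.subset_trans ux; apply/fintype.subsetP => i; rewrite !inE mxE oppr_eq0.
have [i0 ui0] : exists i, u ord0 i < 0.
  apply/existsP; apply/contraT; rewrite negb_exists => /forallP uge.
  have uge0 i : true -> 0 <= u ord0 i by rewrite leNgt uge.
  case/lexposP: up => i ui _; have /eqP := G_sum uG.
  by rewrite psumr_eq0// => /allP/(_ i (mem_index_enum _)); rewrite gt_eqF.
(* [t] is the largest step that keeps [x + t *: u] nonnegative; it is reached at the coordinate [i],
   which becomes zero. *)
case: (@arg_minP _ _ _ i0 (fun i => u ord0 i < 0) (fun i => x ord0 i / - u ord0 i) ui0).
move=> i ui imin; set t := x ord0 i / - u ord0 i in imin.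
have xi : 0 < x ord0 i.
  rewrite lt_def x0 andbT; have /fintype.subsetP/(_ i) := ux; rewrite !inE; apply.
  by rewrite lt_eqF.
have t0 : 0 < t by rewrite divr_gt0// oppr_gt0.
pose y := x + t *: u.
have y0 j : 0 <= y ord0 j.
  rewrite !mxE; have [uj|uj] := leP 0 (u ord0 j).
    by rewrite addr_ge0// mulr_ge0// ltW.
  rewrite -[u ord0 j]opprK mulrN subr_ge0 -ler_pdivlMr ?oppr_gt0//.
  exact: imin.
have yi : y ord0 i = 0.
  by rewrite !mxE /t invrN mulrN mulNr divfK ?subrr// lt_eqF.
have [|z [z0 zG zf zl]] := IH y _ y0.
  apply: leq_trans xk; apply: proper_card; apply/properP; split.
    apply/fintype.subsetP => j; rewrite !inE !mxE; apply: contraNN => /eqP xj.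
    have : j \notin vsupp u by apply/negP => /(fintype.subsetP ux); rewrite inE xj eqxx.
    by rewrite inE negbK xj add0r => /eqP ->; rewrite mulr0.
  by exists i; rewrite inE ?yi ?eqxx// gt_eqF.
exists z; split => //; first by rewrite zG mulmxDl -scalemxAl uG scaler0 addr0.
apply: lexle_trans zl; rewrite /lexle /y opprD addrA subrr add0r.
exact/lexposN/lexposZ.
Qed.

(** A free support carries at most one representation, so those with free support are finitely many
    and have a lexicographic maximum [y]. An increasing move that the support of [y] allows could be
    followed a little, then reduced by [free_reduction] to a larger representation with free
    support. *)
Lemma lexmax_exists x : (forall i, 0 <= x ord0 i) ->
  exists y, [/\ forall i, 0 <= y ord0 i, y *m G = x *m G &
    lexmax_support (vsupp y)].
Proof.
move=> x0.
pose P S y := [/\ forall i, 0 <= y ord0 i, y *m G = x *m G,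
    free_support (vsupp y) & vsupp y = S].
have [f fP] : exists f : {set 'I_m} -> 'rV[R]_m,
    forall S y, P S y -> P S (f S).
  have /choice[f fP] : forall S, exists y, forall z, P S z -> P S y.
    move=> S; have [[y Py]|nP] := pselect (exists y, P S y); first by exists y.
    by exists 0 => y Py; exfalso; apply: nP; exists y.
  by exists f.
(* [s] lists all the representations with free support, [f S] being the one with support [S] if
   there is any. *)
pose s := [seq f A | A <- enum [set A : {set 'I_m} | `[< P A (f A) >]]].
have mems y : P (vsupp y) y -> y \in s.
  move=> Py; have [f0 fG ff fS] := fP _ _ Py.
  have -> : y = f (vsupp y).
    have [y0 yG yf _] := Py; apply: subr0_eq; apply: yf.
      by rewrite mulmxBl yG fG subrr.
    apply/fintype.subsetP => i; apply: contraTT => iy.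
    have : i \notin vsupp (f (vsupp y)) by rewrite fS.
    by move: iy; rewrite !inE !negbK !mxE => /eqP -> /eqP ->; rewrite subr0.
  by apply: map_f; rewrite mem_enum inE; apply/asboolP; exact: fP Py.
have [y0 [y00 y0G y0f _]] := free_reduction x0.
have sN : s != [::].
  by apply/eqP => s0; have := mems y0 (And4 y00 y0G y0f erefl); rewrite s0.
have [_ /mapP[S + ->] ymax] := total_max (@lexle_total R m) (@lexle_trans R m) sN.
rewrite mem_enum inE => /asboolP[+ + _ _].
set y := f S in ymax * => yp yG; exists y; split => // u uG uS.
apply/negP => ul.
(* Where [y] vanishes, [u] is nonnegative; elsewhere [t <= y_i / (1 + |u_i|)] keeps the decrease
   below [y_i]. *)
have [t t0 yt] : exists2 t, 0 < t & forall i, 0 <= (y + t *: u) ord0 i.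
  pose c i := if 0 < y ord0 i then y ord0 i / (1 + `|u ord0 i|) else 1.
  have c0 i : 0 < c i.
    by rewrite /c; case: ifP => // yi; rewrite divr_gt0// ltr_pwDl.
  have [t t0 tc] : exists2 t, 0 < t & forall i, t <= c i.
    exists (\big[Num.min/1]_i c i); last by move=> i; exact: bigmin_le_cond.
    by apply/bigmin_gtP; split.
  exists t => // i; rewrite !mxE.
  have [yi|yi] := ltP 0 (y ord0 i); last first.
    have /uS ui : i \notin vsupp y by rewrite inE negbK eq_le yi yp.
    by rewrite addr_ge0// mulr_ge0// ltW.
  have := tc i; rewrite /c yi ler_pdivlMr ?ltr_pwDl// => h.
  have : - (t * u ord0 i) <= t * `|u ord0 i|.
    by rewrite -mulrN ler_pM2l// -normrN ler_norm.
  rewrite -lerBlDr sub0r => /le_trans; apply; apply: le_trans h.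
  by rewrite mulrDr lerDr mulr1 ltW.
have [z [z0 zG zf zl]] := free_reduction yt.
have /mems/ymax zy : P (vsupp z) z.
  by split => //; rewrite zG mulmxDl -scalemxAl uG scaler0 addr0.
have := lexle_trans zl zy; rewrite /lexle addrC addKr.
by rewrite lexposZ.
Qed.

End GoodSupport.

(** * Denominators *)

Lemma rat_mx_denominator m n (P : 'M[rat]_(m, n)) :
  exists2 D : nat, (0 < D)%N & forall i j, D%:R * P i j \is a Num.int.
Proof.
exists (\prod_i \prod_j `|denq (P i j)|)%N.
  by rewrite prodn_gt0// => i; rewrite prodn_gt0// => j; rewrite absz_gt0 denq_neq0.
move=> i j; rewrite (bigD1 i)//= (bigD1 j)//= 2!natrM mulrAC [_ * P i j]mulrAC.
do 2 (apply: rpredM; last exact: natr_int).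
rewrite natr_absz gtr0_norm ?denq_gt0// mulrC -numqE.
exact: intr_int.
Qed.

(** The rows in [S] are independent, so [x] is recovered from [x A] by a rational matrix, whose
    entries have a common denominator. *)
Lemma free_support_denominator (R : realType) m N (A : 'M[int]_(m, N))
    (S : {set 'I_m}) : free_support (map_mx intr A : 'M[R]_(m, N)) S ->
  exists2 D : nat, (0 < D)%N &
    forall x : 'rV[R]_m, vsupp x \subset S ->
      (forall j, (x *m map_mx intr A) ord0 j \is a Num.int) ->
      forall i, D%:R * x ord0 i \is a Num.int.
Proof.
move=> freeS.
(* On vectors supported in S, this matrix is x |-> (x A, 0). *)
pose d : 'rV[rat]_m := \row_i (i \notin S)%:R.
pose B : 'M[rat]_(m, N + m) := row_mx (map_mx intr A) (diag_mx d).
pose f := @ratr R.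
have dE x : x *m map_mx f (diag_mx d) = \row_i (x ord0 i * (i \notin S)%:R).
  apply/rowP => i; rewrite map_diag_mx mul_mx_diag !mxE.
  by rewrite /f rmorph_nat.
have fA : map_mx f (map_mx intr A) = map_mx intr A.
  by apply/matrixP => i j; rewrite !mxE /f ratr_int.
have xB x : vsupp x \subset S ->
    x *m map_mx f B = row_mx (x *m map_mx intr A) 0.
  move=> /fintype.subsetP xS; rewrite map_row_mx mul_mx_row dE fA; congr row_mx.
  apply/rowP => i; rewrite !mxE; case: (boolP (i \in S)) => iS; rewrite ?mulr0//.
  by rewrite mulr1; apply/eqP; apply: contraNT iS => xi; apply: xS; rewrite inE.
have Bfree : row_free B.
  rewrite -(row_free_map f) -kermx_eq0; apply/eqP/row_matrixP => k; rewrite row0.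
  have : row k (kermx (map_mx f B)) *m map_mx f B = 0.
    by rewrite -row_mul mulmx_ker row0.
  set u := row k _ => uB.
  have := uB; rewrite map_row_mx mul_mx_row dE fA -row_mx0 => /eq_row_mx[uA ud].
  apply: freeS => //; apply/fintype.subsetP => i; rewrite inE; apply: contraNT => iS.
  by have /rowP/(_ i) := ud; rewrite !mxE iS mulr1 => ->.
have [D D0 DP] := rat_mx_denominator (pinvmx B).
exists D => // x xS xA i.
have -> : x = row_mx (x *m map_mx intr A) 0 *m map_mx f (pinvmx B).
  by rewrite -xB// -mulmxA -map_mxM mulmxVp// map_mx1 mulmx1.
rewrite mxE big_distrr rpred_sum// => j _ /=; rewrite mulrCA rpredM//.
  case: (split_ordP j) => k ->; first by rewrite row_mxEl; exact: xA.
  by rewrite row_mxEr mxE rpred0.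
have /intrP[z zE] := DP j i.
have -> : D%:R * (map_mx f (pinvmx B)) j i = f (D%:R * pinvmx B j i).
  by rewrite mxE /f rmorphM /= ratr_nat.
by rewrite zE /f ratr_int intr_int.
Qed.

Lemma free_supports_denominator (R : realType) m N (A : 'M[int]_(m, N)) :
  exists2 D : nat, (0 < D)%N &
    forall x : 'rV[R]_m, free_support (map_mx intr A : 'M[R]_(m, N)) (vsupp x) ->
      (forall j, (x *m map_mx intr A) ord0 j \is a Num.int) ->
      forall i, D%:R * x ord0 i \is a Num.int.
Proof.
have /choice[d dP] : forall S, exists D : nat, (0 < D)%N /\
    (free_support (map_mx intr A : 'M[R]_(m, N)) S ->
     forall x : 'rV[R]_m, vsupp x \subset S ->
      (forall j, (x *m map_mx intr A) ord0 j \is a Num.int) ->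
      forall i, D%:R * x ord0 i \is a Num.int).
  move=> S; have [/free_support_denominator[D D0 DP]|] :=
    pselect (free_support (map_mx intr A : 'M[R]_(m, N)) S); first by exists D.
  by exists 1%N.
exists (\prod_S d S)%N => [|x xf xA i].
  by rewrite prodn_gt0// => S; case: (dP S).
rewrite (bigD1 (vsupp x))//= mulnC natrM -mulrA rpredM ?natr_int//.
by case: (dP (vsupp x)) => _ /(_ xf); apply.
Qed.

(** * Hulls of finite families *)

Section FiniteHulls.
Variables (R : realType) (V : lmodType R) (T : finType) (f : T -> V).

Lemma reindex_enum_val (W : nmodType) (F : T -> W) :
  \sum_(i < #|T|) F (enum_val i) = \sum_t F t.
Proof. by rewrite (reindex _ (onW_bij _ (@enum_val_bij T))). Qed.

(** Coefficients of repeated points are merged, so that hulls, defined with arbitrary finite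
    families, are described by one coefficient per index in [T]. *)
Lemma collect_coefficients k (g : 'I_k -> T) (c : 'I_k -> R) :
  (\sum_t \sum_(i | g i == t) c i = \sum_i c i) /\
  \sum_t (\sum_(i | g i == t) c i) *: f t = \sum_i c i *: f (g i).
Proof.
split; first by rewrite (partition_big g predT).
rewrite [RHS](partition_big g predT)//=; apply: eq_bigr => t _.
by rewrite scaler_suml; apply: eq_bigr => i /eqP ->.
Qed.

Lemma convex_hull_range x : convex_hull (range f) x <->
  exists c : T -> R, [/\ forall t, 0 <= c t, \sum_t c t = 1 & x = \sum_t c t *: f t].
Proof.
split=> [[k [y [c [yf c0 c1 ->]]]]|[c [c0 c1 ->]]].
  have /choice[g gE] : forall i, exists t, f t = y i.
    by move=> i; have [t _ <-] := yf i; exists t.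
  have [s1 s2] := collect_coefficients g c.
  exists (fun t => \sum_(i | g i == t) c i); split.
  - by move=> t; apply: sumr_ge0.
  - by rewrite s1.
  - by rewrite s2; apply: eq_bigr => i _; rewrite gE.
exists #|T|, (f \o enum_val), (c \o enum_val); split => [i|i||] /=.
- by exists (enum_val i).
- exact: c0.
- by rewrite reindex_enum_val.
- by rewrite -(reindex_enum_val (fun t => c t *: f t)).
Qed.

Lemma affine_hull_range x : affine_hull (range f) x <->
  exists c : T -> R, \sum_t c t = 1 /\ x = \sum_t c t *: f t.
Proof.
split=> [[k [y [c [yf c1 ->]]]]|[c [c1 ->]]].
  have /choice[g gE] : forall i, exists t, f t = y i.
    by move=> i; have [t _ <-] := yf i; exists t.
  have [s1 s2] := collect_coefficients g c.
  exists (fun t => \sum_(i | g i == t) c i); split; first by rewrite s1.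
  by rewrite s2; apply: eq_bigr => i _; rewrite gE.
exists #|T|, (f \o enum_val), (c \o enum_val); split => [i||] /=.
- by exists (enum_val i).
- by rewrite reindex_enum_val.
- by rewrite -(reindex_enum_val (fun t => c t *: f t)).
Qed.

(** The coefficients are scaled by [n]. For [n = 0] they all vanish, and [t0] provides a point of
    the hull whose dilate is [0]. *)
Lemma dilate_convex_hull (t0 : T) n x : dilate n (convex_hull (range f)) x <->
  exists c : T -> R,
    [/\ forall t, 0 <= c t, \sum_t c t = n%:R & x = \sum_t c t *: f t].
Proof.
split=> [[_ /convex_hull_range[c [c0 c1 ->]] <-]|[c [c0 cn ->]]].
  exists (fun t => n%:R * c t); split => [t||]; first by rewrite mulr_ge0.
    by rewrite -big_distrr /= c1 mulr1.
  by rewrite scaler_sumr; apply: eq_bigr => t _; rewrite scalerA.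
have [n0|n0] := eqVneq n 0%N.
  have cE t : c t = 0.
    have /eqP := cn; rewrite n0 psumr_eq0 => [/allP|//].
    by move=> /(_ t (mem_index_enum _))/eqP.
  rewrite big1 => [|t _]; last by rewrite cE scale0r.
  exists (f t0); last by rewrite n0 scale0r.
  apply/convex_hull_range; exists (fun t => (t == t0)%:R); split => //.
    by rewrite (bigD1 t0)//= eqxx big1 ?addr0// => t /negPf ->.
  rewrite (bigD1 t0)//= eqxx scale1r big1 ?addr0// => t /negPf ->.
  by rewrite scale0r.
have n0' : n%:R != 0 :> R by rewrite pnatr_eq0.
exists (\sum_t (n%:R^-1 * c t) *: f t).
  apply/convex_hull_range; exists (fun t => n%:R^-1 * c t); split => // [t|].
    by rewrite mulr_ge0// invr_ge0.
  by rewrite -big_distrr /= cn mulVf.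
rewrite scaler_sumr; apply: eq_bigr => t _.
by rewrite scalerA mulrA mulfV// mul1r.
Qed.

Lemma affine_hull_convex_hull : affine_hull (convex_hull (range f)) = affine_hull (range f).
Proof.
apply/seteqP; split => x; last first.
  move=> /affine_hull_range[c [c1 ->]]; exists #|T|, (f \o enum_val), (c \o enum_val).
  split => [i||] /=; last 2 first.
  - by rewrite reindex_enum_val.
  - by rewrite -(reindex_enum_val (fun t => c t *: f t)).
  apply/convex_hull_range; exists (fun t => (t == enum_val i)%:R); split => //.
    by rewrite (bigD1 (enum_val i))//= eqxx big1 ?addr0// => t /negPf ->.
  rewrite (bigD1 (enum_val i))//= eqxx scale1r big1 ?addr0// => t /negPf ->.
  by rewrite scale0r.
move=> [k [y [c [yf c1 ->]]]]; apply/affine_hull_range.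
have /choice[d dE] : forall i, exists d : T -> R,
    \sum_t d t = 1 /\ y i = \sum_t d t *: f t.
  by move=> i; have /convex_hull_range[d [_ d1 yE]] := yf i; exists d.
exists (fun t => \sum_i c i * d i t); split.
  rewrite exchange_big /= -c1; apply: eq_bigr => i _.
  by rewrite -big_distrr /= (dE i).1 mulr1.
under [RHS]eq_bigr do rewrite scaler_suml.
rewrite exchange_big /=; apply: eq_bigr => i _.
by rewrite (dE i).2 scaler_sumr; apply: eq_bigr => t _; rewrite scalerA.
Qed.

End FiniteHulls.

Definition vertex_mx (R : realType) m s (v : 'I_m -> 'rV[nat]_s) : 'M[R]_(m, s) :=
  \matrix_(i, j) (v i ord0 j)%:R.
Arguments vertex_mx R {m s} v.

Lemma sum_vertices (R : realType) m s (v : 'I_m -> 'rV[nat]_s) (c : 'I_m -> R) :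
  \sum_i c i *: map_mx (fun n => n%:R) (v i) = (\row_i c i) *m vertex_mx R v.
Proof.
apply/rowP => j; rewrite summxE mxE; apply: eq_bigr => i _.
by rewrite !mxE.
Qed.

Lemma dilate_polytope (R : realType) m s (v : 'I_m -> 'rV[nat]_s) (i0 : 'I_m)
    n (a : 'rV[R]_s) : dilate n (polytope R v) a <->
  exists x : 'rV[R]_m, [/\ forall i, 0 <= x ord0 i, \sum_i x ord0 i = n%:R &
    a = x *m vertex_mx R v].
Proof.
rewrite /polytope; split.
  move=> /(dilate_convex_hull _ i0)[c [c0 cn ->]]; exists (\row_i c i); split.
  - by move=> i; rewrite mxE.
  - by rewrite -cn; apply: eq_bigr => i _; rewrite mxE.
  - exact: sum_vertices.
move=> [x [x0 xn ->]]; apply/(dilate_convex_hull _ i0); exists (x ord0); split => //.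
rewrite sum_vertices; congr (_ *m _); apply/rowP => i; by rewrite mxE.
Qed.

Lemma integer_pointsP (R : realType) N (x : 'rV[R]_N) :
  integer_points R N x <-> forall i, x ord0 i \is a Num.int.
Proof.
split=> [[z _ <-] i|xint]; first by rewrite mxE intr_int.
have /choice[z zE] : forall i, exists z : int, x ord0 i = z%:~R.
  by move=> i; have /intrP := xint i.
by exists (\row_i z i) => //; apply/rowP => i; rewrite !mxE zE.
Qed.

(** * Polynomiality of the weighted count *)

Section CeilCoordinates.
Variables (R : realType) (D : nat).
Hypothesis D0 : (0 < D)%N.

Let D0R : 0 < D%:R :> R. Proof. by rewrite ltr0n. Qed.

(** For [r < D] this is the number with ceiling [c] and defect [r / D]. Ceilings are preferred to
    floors because, with [r = 0] imposed when [c = 0], the number is positive exactly when [c]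
    is. *)
Definition ceil_coord (c r : nat) : R := c%:R - r%:R / D%:R.

Lemma ceil_coord00 : ceil_coord 0 0 = 0.
Proof. by rewrite /ceil_coord mul0r subrr. Qed.

Lemma ceil_coordE c r : D%:R * ceil_coord c r = (c * D)%:R - r%:R.
Proof. by rewrite mulrBr natrM mulrC [_ * (_ / _)]mulrC divfK ?gt_eqF. Qed.

Lemma ceil_coord_gt0 c r : (0 < c)%N -> (r < D)%N -> 0 < ceil_coord c r.
Proof.
move=> c0 rD; rewrite subr_gt0 ltr_pdivrMr// -natrM ltr_nat.
by rewrite (leq_trans rD)// leq_pmull.
Qed.

Lemma ceil_coord_inj c r c' r' : (r < D)%N -> (r' < D)%N ->
  ceil_coord c r = ceil_coord c' r' -> c = c' /\ r = r'.
Proof.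
move=> rD r'D /(congr1 ( *%R D%:R)); rewrite !ceil_coordE => /eqP.
rewrite subr_eq addrAC eq_sym subr_eq -!natrD eqr_nat => /eqP e.
have er : r = r'.
  by have := congr1 (modn^~ D) e; rewrite !modnMDl !modn_small.
by split=> //; move/eqP: e; rewrite er eqn_add2r eqn_pmul2r// => /eqP.
Qed.

Lemma ceil_coord_exists (t : R) : 0 <= t -> D%:R * t \is a Num.int ->
  exists c r, [/\ (r < D)%N, c = 0%N -> r = 0%N & t = ceil_coord c r].
Proof.
move=> t0 tint.
have /natrP[l lE] : D%:R * t \is a Num.nat.
  by rewrite natrEint tint mulr_ge0// ltW.
have tE c r : (l + r = c * D)%N -> t = ceil_coord c r.
  move=> e; apply: (mulfI (lt0r_neq0 D0R)); rewrite lE ceil_coordE -e natrD.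
  by rewrite addrK.
have [l0|l0] := eqVneq (l %% D)%N 0%N.
  exists (l %/ D)%N, 0%N; split => //; apply: tE.
  by rewrite [in LHS](divn_eq l D) l0 !addn0.
exists (l %/ D).+1, (D - l %% D)%N; split => //.
  by rewrite ltn_subrL lt0n l0.
apply: tE; rewrite [in X in (X + _)%N](divn_eq l D) -addnA subnKC ?mulSn 1?addnC//.
by rewrite ltnW// ltn_pmod.
Qed.

End CeilCoordinates.

(** * Parametrization of the lattice points by ceilings and residues *)

Section WeightedCount.
Variables (R : realType) (m s p : nat) (v : 'I_m -> 'rV[nat]_s) (e : 'I_p -> 'I_s).
Hypothesis p0 : (0 < p)%N.

Let V : 'M[R]_(m, s) := vertex_mx R v.
(** Homogenized vertices [(v_i, 1)]: the image of [x] records the point [x *m V] together with the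
    dilation factor. *)
Let Ai : 'M[int]_(m, s + 1) :=
  row_mx (\matrix_(i, j) (v i ord0 j)%:Z) (const_mx 1).
Let G : 'M[R]_(m, s + 1) := map_mx intr Ai.

Let mulG (x : 'rV[R]_m) : x *m G = row_mx (x *m V) (const_mx (\sum_i x ord0 i)).
Proof.
rewrite /G map_row_mx mul_mx_row; congr row_mx.
  by congr (_ *m _); apply/matrixP => i j; rewrite !mxE.
by apply/rowP => j; rewrite !mxE; apply: eq_bigr => i _; rewrite !mxE mulr1.
Qed.

Let mulG_eq (x y : 'rV[R]_m) : x *m V = y *m V ->
  \sum_i x ord0 i = \sum_i y ord0 i -> x *m G = y *m G.
Proof. by rewrite !mulG => -> ->. Qed.

Let mulG_inv (x y : 'rV[R]_m) : x *m G = y *m G ->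
  x *m V = y *m V /\ \sum_i x ord0 i = \sum_i y ord0 i.
Proof.
rewrite !mulG => /eq_row_mx[-> /rowP/(_ ord0)]; by rewrite !mxE.
Qed.

Let G_sum (u : 'rV[R]_m) : u *m G = 0 -> \sum_i u ord0 i = 0.
Proof.
rewrite -(mul0mx _ G) => /mulG_inv[_ ->]; by rewrite big1// => i _; rewrite mxE.
Qed.

Section Denominator.
Variable D : nat.
Hypothesis D0 : (0 < D)%N.

Let lat M (rho : {ffun 'I_m -> 'I_D}) (c : {ffun 'I_m -> 'I_M}) : 'rV[R]_m :=
  \row_i ceil_coord R D (c i) (rho i).

(** The ceilings contribute integers, so this is the condition on the residues under which
    [lat rho c] represents an integer point in an integer dilate. *)
Let integral_residue (rho : {ffun 'I_m -> 'I_D}) : bool :=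
  [forall j, D %| \sum_i rho i * v i ord0 j]%N && (D %| \sum_i rho i)%N.

Let shift (rho : {ffun 'I_m -> 'I_D}) : nat := ((\sum_i rho i) %/ D)%N.

Let zero_off (rho : {ffun 'I_m -> 'I_D}) (S : {set 'I_m}) : bool :=
  [forall i, (i \notin S) ==> (rho i == 0 :> nat)].

Let csupp M (c : {ffun 'I_m -> 'I_M}) : {set 'I_m} := [set i | c i != 0 :> nat].

(** Index set for the lattice points of the [n]-th dilate. The ceilings may be bounded by [n + m],
    since they add up to [n] plus a shift that is at most [m]. *)
Let valid n (k : {ffun 'I_m -> 'I_D} * {ffun 'I_m -> 'I_(n + m).+1}) : bool :=
  [&& integral_residue k.1,
      zero_off k.1 (csupp k.2) && `[< lexmax_support G (csupp k.2) >] &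
      (\sum_i k.2 i == n + shift k.1)%N].

Let lat_ge0 M rho (c : {ffun 'I_m -> 'I_M}) : zero_off rho (csupp c) ->
  (forall i, 0 <= lat rho c ord0 i) /\ vsupp (lat rho c) = csupp c.
Proof.
move=> /forallP z; split => [i|]; last apply/setP => i; rewrite ?inE mxE.
  have := z i; rewrite inE negbK; have [-> /= /eqP ->|c0 _] := eqVneq (c i : nat) 0%N.
    by rewrite ceil_coord00.
  by rewrite ltW// ceil_coord_gt0// lt0n.
have := z i; rewrite inE negbK; have [-> /= /eqP ->|c0 _] := eqVneq (c i : nat) 0%N.
  by rewrite ceil_coord00 eqxx.
by rewrite gt_eqF// ceil_coord_gt0// lt0n.
Qed.

Let sum_lat M rho (c : {ffun 'I_m -> 'I_M}) :
  \sum_i lat rho c ord0 i = (\sum_i c i)%N%:R - (\sum_i rho i)%N%:R / D%:R.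
Proof.
rewrite !natr_sum big_distrl -sumrB; apply: eq_bigr => i _; by rewrite mxE.
Qed.

Let lat_mul M rho (c : {ffun 'I_m -> 'I_M}) j : (lat rho c *m V) ord0 j =
  (\sum_i c i * v i ord0 j)%N%:R - (\sum_i rho i * v i ord0 j)%N%:R / D%:R.
Proof.
rewrite mxE !natr_sum big_distrl -sumrB; apply: eq_bigr => i _.
by rewrite !mxE mulrBl !natrM mulrAC.
Qed.

Let dvd_ratio (a : nat) : (D %| a)%N -> a%:R / D%:R = (a %/ D)%N%:R :> R.
Proof.
by move=> Da; rewrite -[in LHS](divnK Da) natrM mulfK// pnatr_eq0 -lt0n.
Qed.

Let ratio_dvd (a : nat) : a%:R / D%:R \is a @Num.int R -> (D %| a)%N.
Proof.
move=> aD; have /natrP[q qE] : a%:R / D%:R \is a @Num.nat R.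
  by rewrite natrEint aD divr_ge0.
apply/dvdnP; exists q; apply/eqP; rewrite -(eqr_nat R) natrM -qE divfK//.
by rewrite pnatr_eq0 -lt0n.
Qed.

Let valid_sum n k : @valid n k -> \sum_i lat k.1 k.2 ord0 i = n%:R.
Proof.
move=> /and3P[/andP[_ Ds] _ /eqP cs].
by rewrite sum_lat cs dvd_ratio// natrD addrK.
Qed.

(** The point and the total determine the representation by [lexmax_uniq], and each coordinate
    determines its ceiling and residue. *)
Let valid_inj n : {in @valid n &, injective (fun k => lat k.1 k.2 *m V)}.
Proof.
move=> k k' vk vk' kk'.
have ss : \sum_i lat k.1 k.2 ord0 i = \sum_i lat k'.1 k'.2 ord0 i.
  by rewrite !valid_sum.
move: vk vk' => /and3P[_ /andP[z /asboolP l] _] /and3P[_ /andP[z' /asboolP l'] _].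
have [x0 xs] := lat_ge0 z; have [x0' xs'] := lat_ge0 z'.
rewrite -xs in l; rewrite -xs' in l'.
have := lexmax_uniq x0 x0' l l' (mulG_eq kk' ss).
move=> /rowP E.
have H i : (k.2 i = k'.2 i :> nat) /\ (k.1 i = k'.1 i :> nat).
  by have := E i; rewrite !mxE; apply: ceil_coord_inj.
rewrite [k]surjective_pairing [k']surjective_pairing; congr pair; apply/ffunP => i; apply: val_inj.
  by case: (H i).
by case: (H i).
Qed.

Hypothesis DP : forall x : 'rV[R]_m, free_support G (vsupp x) ->
  (forall j, (x *m G) ord0 j \is a Num.int) ->
  forall i, D%:R * x ord0 i \is a Num.int.

(** For a lattice point, the representation given by [lexmax_exists] has a free support, so [D]
    clears its denominators; the ceilings and residues of its coordinates form a valid index. *)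
Let lattice_pointE (i0 : 'I_m) n : dilate n (polytope R v) `&` integer_points R s =
  [set` [seq lat k.1 k.2 *m V | k <- enum (@valid n)]].
Proof.
apply/seteqP; split => a; last first.
  move=> /mapP[k + ->]; rewrite mem_enum => vk; split.
    apply/(dilate_polytope v i0); exists (lat k.1 k.2); split => //.
      by move: vk => /and3P[_ /andP[z _] _]; case: (lat_ge0 z).
    exact: valid_sum.
  apply/integer_pointsP => j; rewrite lat_mul.
  move: vk => /and3P[/andP[/forallP Dj _] _ _].
  by rewrite dvd_ratio// rpredB// natr_int.
move=> [/(dilate_polytope v i0)[x [x0 xn ->]] /integer_pointsP aint].
have [y [y0 yG yl]] := lexmax_exists G_sum x0.
have [yV yn] := mulG_inv yG; rewrite -yV in aint *; rewrite xn in yn.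
have Dy i : D%:R * y ord0 i \is a Num.int.
  apply: DP => [|j]; first exact: lexmax_free.
  rewrite mulG; case: (split_ordP j) => k ->; first by rewrite row_mxEl.
  by rewrite row_mxEr mxE yn natr_int.
have /choice[cr crP] : forall i, exists cr : nat * nat, [/\ (cr.2 < D)%N,
    cr.1 = 0%N -> cr.2 = 0%N & y ord0 i = ceil_coord R D cr.1 cr.2].
  by move=> i; have [c [r h]] := ceil_coord_exists D0 (y0 i) (Dy i); exists (c, r).
have rD i : ((cr i).2 < D)%N by case: (crP i).
have cM i : ((cr i).1 < (n + m).+1)%N.
  have [rDi _ yE] := crP i.
  have yin : y ord0 i <= n%:R.
    by rewrite -yn (bigD1 i)//= lerDl sumr_ge0.
  rewrite ltnS (leq_trans _ (leq_addr _ _))// -ltnS -(ltr_nat R) -natr1.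
  rewrite -ltrBlDr; apply: lt_le_trans yin; rewrite yE ltrD2l ltrN2.
  by rewrite ltr_pdivrMr ?ltr0n// mul1r ltr_nat.
pose k : {ffun 'I_m -> 'I_D} * {ffun 'I_m -> 'I_(n + m).+1} :=
  ([ffun i => Ordinal (rD i)], [ffun i => Ordinal (cM i)]).
have latE : lat k.1 k.2 = y.
  by apply/rowP => i; rewrite mxE !ffunE /=; case: (crP i).
have z : zero_off k.1 (csupp k.2).
  apply/forallP => i; rewrite inE negbK !ffunE /=; apply/implyP => /eqP c0.
  by apply/eqP; case: (crP i) => _ ->.
apply/mapP; exists k; last by rewrite latE.
rewrite mem_enum; apply/and3P.
have [_ sE] := lat_ge0 z.
have Ds : (D %| \sum_i k.1 i)%N.
  apply: ratio_dvd; rewrite -[X in X \is a _](subKr (\sum_i k.2 i)%N%:R).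
  by rewrite -sum_lat latE yn rpredB ?natr_int.
split.
- rewrite /integral_residue Ds andbT; apply/forallP => j; apply: ratio_dvd.
  rewrite -[X in X \is a _](subKr (\sum_i k.2 i * v i ord0 j)%N%:R).
  by rewrite -lat_mul latE rpredB ?natr_int.
- by rewrite z; apply/asboolP; rewrite -sE latE.
- rewrite -(eqr_nat R) natrD -dvd_ratio//.
  by rewrite -subr_eq -sum_lat latE yn.
Qed.

Let weight (a : 'rV[R]_s) : R := \prod_(j < p) a ord0 (e j).

Let weighted_ehrhartE (i0 : 'I_m) n :
  weighted_ehrhart (polytope R v) (fun j => coordinate (e j)) n =
  \sum_(k | @valid n k) weight (lat k.1 k.2 *m V).
Proof.
rewrite /weighted_ehrhart (lattice_pointE i0) -fsbig_seq.
  by rewrite big_map big_enum_cond; apply: eq_bigl => k; rewrite andbT.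
rewrite map_inj_in_uniq ?enum_uniq// => k k'; rewrite !mem_enum; exact: valid_inj.
Qed.

(** Expanding the product of the [p] linear forms chooses a vertex [phi j] in each factor; the
    factors that chose [i] are collected here, as a polynomial in the ceiling [c i]. *)
Let base (rho : {ffun 'I_m -> 'I_D}) (phi : {ffun 'I_p -> 'I_m}) i : {poly R} :=
  ('X - ((rho i)%:R / D%:R)%:P) ^+ #|[pred j | phi j == i]|.

Let prod_base M rho (c : {ffun 'I_m -> 'I_M}) (phi : {ffun 'I_p -> 'I_m}) :
  \prod_j lat rho c ord0 (phi j) = \prod_i (base rho phi i).[(c i)%:R].
Proof.
rewrite (partition_big phi predT)//=; apply: eq_bigr => i _.
rewrite horner_exp hornerXsubC -prodr_const.
by apply: eq_big => j; [rewrite inE|move=> /eqP ->; rewrite mxE].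
Qed.

Let weight_lat M rho (c : {ffun 'I_m -> 'I_M}) : weight (lat rho c *m V) =
  \sum_(phi : {ffun 'I_p -> 'I_m})
    (\prod_j V (phi j) (e j)) * \prod_i (base rho phi i).[(c i)%:R].
Proof.
rewrite /weight; under eq_bigr do rewrite mxE.
rewrite bigA_distr_bigA; apply: eq_bigr => phi _ /=.
by rewrite big_split /= mulrC prod_base.
Qed.

(** With all residues zero the factors are powers of ['X], and the vertex chosen by the first of the
    [p >= 1] linear forms has a positive exponent. *)
Let base0 (rho : {ffun 'I_m -> 'I_D}) phi :
  (\sum_i rho i = 0)%N -> \prod_i (base rho phi i).[0] = 0.
Proof.
move=> r0; pose j := Ordinal p0; rewrite (bigD1 (phi j))//= horner_exp hornerXsubC.
have -> : rho (phi j) = 0%N :> nat.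
  by apply/eqP; move/eqP: r0; rewrite sum_nat_eq0 => /forallP/(_ (phi j)).
rewrite mul0r subrr expr0n; case: eqP => [|_]; last by rewrite mul0r.
by move=> /card0_eq/(_ j); rewrite !inE eqxx.
Qed.

Let shift_lt (rho : {ffun 'I_m -> 'I_D}) : (shift rho <= m)%N.
Proof.
rewrite /shift -(leq_pmul2r D0); apply: leq_trans (leq_trunc_div _ _) _.
rewrite -[X in (_ <= X * _)%N]card_ord -sum_nat_const leq_sum// => i _.
exact: ltnW.
Qed.

(** For nonempty [S] this is [supported_sum_poly] composed with the translation by the shift. For
    empty [S] the residues are zero and only [c = 0] can occur, with a term that vanishes by
    [base0]. *)
Let polyfun_support rho (S : {set 'I_m}) phi : integral_residue rho -> zero_off rho S ->
  polyfun (fun n => \sum_(c : {ffun 'I_m -> 'I_(n + m).+1} |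
      [forall i, (c i != 0 :> nat) == (i \in S)] && (\sum_i c i == n + shift rho)%N)
    \prod_i (base rho phi i).[(c i)%:R]).
Proof.
move=> /andP[_ Drho] /forallP z; have [S0|S0] := eqVneq S finset.set0.
  apply: eq_polyfun (polyfunC 0) => n; rewrite big1// => c /andP[/forallP cS _].
  rewrite -(@base0 rho phi).
    by apply: eq_bigr => i _; have := cS i; rewrite S0 inE => /eqP/negbFE/eqP ->.
  by apply: big1 => i _; apply/eqP; have := z i; rewrite S0 inE.
have [q qE] := supported_sum_poly (base rho phi) S0.
exists (q \Po ('X + (shift rho)%:R%:P)) => n.
rewrite horner_comp hornerD hornerX hornerC -natrD; apply: qE.
  by rewrite ltnS leq_add2l.
(* A positive shift makes the total positive. A zero shift means that all residues vanish, as [D]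
   divides their sum, and [base0] covers the total [0]. *)
have [r0|r0] := posnP (shift rho); last by left; rewrite addn_gt0 r0 orbT.
right; apply: base0; rewrite -(divnK Drho) -/(shift rho) r0.
by rewrite mul0n.
Qed.

(** The sum over valid indices is split by residues, support of the ceilings and expansion [phi];
    none of these three ranges depends on [n]. *)
Lemma polyfun_weighted_ehrhart_denominator (i0 : 'I_m) :
  polyfun (weighted_ehrhart (polytope R v) (fun j => coordinate (e j))).
Proof.
apply: (@eq_polyfun _ (fun n =>
  \sum_(rho | integral_residue rho)
  \sum_(S : {set 'I_m} | zero_off rho S && `[< lexmax_support G S >])
  \sum_(phi : {ffun 'I_p -> 'I_m}) (\prod_j V (phi j) (e j)) *
  \sum_(c : {ffun 'I_m -> 'I_(n + m).+1} |
      [forall i, (c i != 0 :> nat) == (i \in S)] && (\sum_i c i == n + shift rho)%N)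
    \prod_i (base rho phi i).[(c i)%:R])); last first.
  apply: polyfun_sum => rho irho; apply: polyfun_sum => S /andP[z _].
  apply: polyfun_sum => phi _; apply: polyfunM; first exact: polyfunC.
  exact: polyfun_support.
move=> n; rewrite (weighted_ehrhartE i0).
rewrite (eq_bigl (fun k => integral_residue k.1 &&
    (zero_off k.1 (csupp k.2) && `[< lexmax_support G (csupp k.2) >] &&
    (\sum_i k.2 i == n + shift k.1)%N))) //.
rewrite -(pair_big_dep integral_residue (fun rho c =>
    (zero_off rho (csupp c) && `[< lexmax_support G (csupp c) >] &&
    (\sum_i c i == n + shift rho)%N)) (fun rho c => weight (lat rho c *m V))) /=.
apply: eq_bigr => rho irho.
rewrite [RHS](partition_big (@csupp (n + m).+1)
  (fun S => zero_off rho S && `[< lexmax_support G S >])) /=; last first.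
  by move=> c /andP[].
apply: eq_bigr => S zl.
rewrite (eq_bigl (fun c : {ffun 'I_m -> 'I_(n + m).+1} =>
   [forall i, (c i != 0 :> nat) == (i \in S)] && (\sum_i c i == n + shift rho)%N)); last first.
  move=> c; have -> : [forall i, (c i != 0 :> nat) == (i \in S)] = (csupp c == S).
    apply/forallP/eqP => [h|<- i]; last by rewrite inE.
    by apply/setP => i; rewrite inE (eqP (h i)).
  by have [->|] := eqVneq (csupp c) S; rewrite ?andbF// zl andbT.
under [RHS]eq_bigr do rewrite weight_lat.
by rewrite [RHS]exchange_big; apply: eq_bigr => phi _; rewrite big_distrr.
Qed.

Lemma finite_lattice_points_denominator (i0 : 'I_m) n : exists2 r : seq 'rV[R]_s,
  uniq r & dilate n (polytope R v) `&` integer_points R s = [set` r].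
Proof.
exists [seq lat k.1 k.2 *m V | k <- enum (@valid n)]; last exact: lattice_pointE.
rewrite map_inj_in_uniq ?enum_uniq// => k k'; rewrite !mem_enum; exact: valid_inj.
Qed.

End Denominator.

Lemma finite_lattice_points (i0 : 'I_m) n : exists2 r : seq 'rV[R]_s,
  uniq r & dilate n (polytope R v) `&` integer_points R s = [set` r].
Proof.
have [D D0 DP] := free_supports_denominator R Ai.
exact: finite_lattice_points_denominator D0 DP i0 n.
Qed.

Lemma polyfun_weighted_ehrhart (i0 : 'I_m) :
  polyfun (weighted_ehrhart (polytope R v) (fun j => coordinate (e j))).
Proof.
have [D D0 DP] := free_supports_denominator R Ai.
exact: polyfun_weighted_ehrhart_denominator D0 DP i0.
Qed.

End WeightedCount.

(** * Dimension and lattice frames *)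

Section Dimension.
Variables (R : realType) (N : nat).

(** Differences of points turn an inclusion of affine images into one of row spaces, which compares
    the ranks. *)
Lemma affine_image_dim d1 d2 (x1 x2 : 'rV[R]_N) (B1 : 'M[R]_(d1, N)) (B2 : 'M[R]_(d2, N)) :
  row_free B1 -> row_free B2 ->
  [set x1 + u *m B1 | u in [set: 'rV[R]_d1]] =
  [set x2 + u *m B2 | u in [set: 'rV[R]_d2]] -> d1 = d2.
Proof.
have le e1 e2 (y1 y2 : 'rV[R]_N) (C1 : 'M[R]_(e1, N)) (C2 : 'M[R]_(e2, N)) :
    row_free C1 -> row_free C2 ->
    [set y1 + u *m C1 | u in [set: 'rV[R]_e1]] `<=`
    [set y2 + u *m C2 | u in [set: 'rV[R]_e2]] -> (e1 <= e2)%N.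
  move=> f1 f2 sub; move: (f1) (f2); rewrite /row_free => /eqP r1 /eqP r2.
  rewrite -r1 -r2; apply/mxrankS/rV_subP => x /submxP[u xE].
  have [u0 _ y1E] := sub _ (ex_intro2 _ _ 0 I erefl).
  have [u1 _ xE'] := sub _ (ex_intro2 _ _ u I erefl).
  apply/submxP; exists (u1 - u0); rewrite mulmxBl xE.
  have {}y1E : y2 + u0 *m C2 = y1 by rewrite y1E mul0mx addr0.
  by rewrite -[LHS](addKr y1) -xE' -y1E opprD addrACA addNr add0r addrC.
move=> f1 f2 e; apply/eqP; rewrite eqn_leq.
by rewrite (le _ _ x1 x2 B1 B2) ?(le _ _ x2 x1 B2 B1)// e.
Qed.

Lemma affine_dimE (A : set 'rV[R]_N) d (x0 : 'rV[R]_N) (B : 'M[R]_(d, N)) :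
  row_free B -> affine_hull A = [set x0 + u *m B | u in [set: 'rV[R]_d]] ->
  affine_dim A = d.
Proof.
move=> Bf AE; rewrite /affine_dim.
set D := (X in get X); have /getPex[x1 [B1 [B1f A1]]] : exists d, D d.
  by exists d, x0, B.
by apply: (affine_image_dim B1f Bf); exact: etrans (esym A1) AE.
Qed.

End Dimension.

(** * Existence of a lattice frame *)

Section PolytopeFrame.
Variables (R : realType) (m s : nat) (v : 'I_m -> 'rV[nat]_s) (i0 : 'I_m).

Lemma affine_hull_polytope x : affine_hull (polytope R v) x <->
  exists c : 'rV[R]_m, \sum_i c ord0 i = 1 /\ x = c *m vertex_mx R v.
Proof.
rewrite /polytope affine_hull_convex_hull; split.
  move=> /affine_hull_range[c [c1 ->]]; exists (\row_i c i).
  rewrite sum_vertices; split => //.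
  by rewrite -c1; apply: eq_bigr => i _; rewrite mxE.
move=> [c [c1 ->]]; apply/affine_hull_range; exists (c ord0); rewrite sum_vertices.
by split => //; congr (_ *m _); apply/rowP => i; rewrite mxE.
Qed.

(** Take the Smith normal form [L *m Dg *m U] of the differences with [v i0]. The direction space is
    spanned by the rows of [U] at the nonzero invariant factors; as [U] is unimodular, these rows
    generate all the integer points of that space, not only a sublattice. *)
Lemma polytope_lattice_frame : exists d (x0 : 'rV[R]_s) (B : 'M[R]_(d, s)),
  lattice_frame (polytope R v) x0 B.
Proof.
pose A : 'M[int]_(m, s) := \matrix_(i, j) ((v i ord0 j)%:Z - (v i0 ord0 j)%:Z).
have [L Lu [U Uu [dd _ AE]]] := int_Smith_normal_form A.
pose toR k l (M : 'M[int]_(k, l)) : 'M[R]_(k, l) := map_mx intr M.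
set Dg : 'M[int]_(m, s) := (X in _ *m X *m _) in AE.
(* [K] marks the nonzero invariant factors; [S] embeds the coordinates in [K] into all of them. *)
pose K : {set 'I_s} := [set k : 'I_s | (k < m)%N && (dd`_k != 0)]%SET.
pose S : 'M[R]_(#|K|, s) := \matrix_(i, k) (enum_val i == k)%:R.
have SS : S *m S^T = 1%:M.
  apply/matrixP => i j; rewrite !mxE (bigD1 (enum_val i))//= !mxE eqxx mul1r.
  rewrite big1 ?addr0 => [|k /negPf ki]; last by rewrite !mxE eq_sym ki mul0r.
  by rewrite (inj_eq enum_val_inj) eq_sym.
have SK (y : 'rV[R]_s) : (forall k, k \notin K -> y ord0 k = 0) -> y *m S^T *m S = y.
  move=> yK; apply/rowP => k; rewrite mxE.
  have [kK|kK] := boolP (k \in K); last first.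
    rewrite yK// big1// => i _; rewrite [S i k]mxE; case: eqP => [ik|]; rewrite ?mulr0//.
    by have := enum_valP i; rewrite ik (negPf kK).
  rewrite (bigD1 (enum_rank_in kK k))//= big1 => [|i ik].
    rewrite addr0 !mxE enum_rankK_in// eqxx mulr1 (bigD1 k)//= !mxE enum_rankK_in// eqxx.
    by rewrite mulr1 big1 ?addr0// => l /negPf lk; rewrite !mxE enum_rankK_in// eq_sym lk mulr0.
  rewrite [S i k]mxE; case: eqP => [e|]; rewrite ?mulr0//; case/eqP: ik.
  by apply: enum_val_inj; rewrite enum_rankK_in.
have SK0 (u : 'rV[R]_#|K|) k : k \notin K -> (u *m S) ord0 k = 0.
  move=> kK; rewrite mxE big1// => i _; rewrite mxE; case: eqP => [ik|]; rewrite ?mulr0//.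
  by have := enum_valP i; rewrite ik (negPf kK).
have DgK (c : 'rV[R]_m) k : k \notin K -> (c *m toR _ _ Dg) ord0 k = 0.
  move=> kK; rewrite mxE big1// => i _; rewrite !mxE.
  case: (eqVneq (i : nat) k) => [ik|]; rewrite ?mulr0n ?mulr0//=.
  move: kK; rewrite inE -ik ltn_ord /= negbK => /eqP ->.
  by rewrite mul0rn mulr0.
(* Over [R] the nonzero invariant factors can be divided by, so [Dg] reaches every vector supported
   in [K]. *)
have DgI (y : 'rV[R]_s) : (forall k, k \notin K -> y ord0 k = 0) ->
    exists c : 'rV[R]_m, c *m toR _ _ Dg = y.
  move=> yK.
  exists (\row_i (if insub (val i) is Some k then y ord0 k / (dd`_(val i))%:~R else 0)).
  apply/rowP => k; rewrite mxE.
  have [kK|kK] := boolP (k \in K); last first.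
    rewrite yK// big1// => i _; rewrite !mxE.
    case: (eqVneq (i : nat) k) => [ik|]; rewrite ?mulr0n ?mulr0//=.
    move: kK; rewrite inE -ik ltn_ord /= negbK => /eqP ->.
    by rewrite mul0rn mulr0.
  have := kK; rewrite inE => /andP[km dk].
  rewrite (bigD1 (Ordinal km))//= big1 => [|i ik]; last first.
    rewrite !mxE; case: eqP => [e|]; rewrite ?mulr0n ?mulr0//.
    by case/eqP: ik; apply: val_inj.
  rewrite addr0 !mxE /= eqxx mulr1n valK /= divfK//.
  by rewrite intr_eq0.
have toRM k l q (M1 : 'M[int]_(k, l)) (M2 : 'M[int]_(l, q)) :
    toR _ _ (M1 *m M2) = toR _ _ M1 *m toR _ _ M2.
  exact: map_mxM.
have inv n (M : 'M[int]_n) : M \in unitmx ->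
    toR _ _ M *m toR _ _ (invmx M) = 1%:M /\ toR _ _ (invmx M) *m toR _ _ M = 1%:M.
  by move=> Mu; rewrite -!toRM mulmxV// mulVmx// /toR map_mx1.
have [LV VL] := inv _ _ Lu; have [UV VU] := inv _ _ Uu.
have affE (x : 'rV[R]_s) : affine_hull (polytope R v) x <->
    exists c : 'rV[R]_m, x = map_mx (fun n => n%:R) (v i0) + c *m toR _ _ A.
  have EA (c : 'rV[R]_m) : c *m toR _ _ A = c *m vertex_mx R v -
      (\sum_i c ord0 i) *: map_mx (fun n => n%:R) (v i0).
    apply/rowP => j; rewrite !mxE big_distrl -sumrB; apply: eq_bigr => i _ /=.
    by rewrite !mxE rmorphB /= mulrBr.
  split=> [/affine_hull_polytope[c [c1 ->]]|[c ->]].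
    by exists c; rewrite EA c1 scale1r addrC subrK.
  (* The coefficient of [v i0] is corrected to make the sum [1]; the row of [A] at [i0] is zero. *)
  apply/affine_hull_polytope; exists (c + (1 - \sum_i c ord0 i) *: delta_mx ord0 i0).
  split.
    rewrite (eq_bigr (fun i => c ord0 i + (1 - \sum_i c ord0 i) * (i == i0)%:R)).
      have delta1 : \sum_i (i == i0)%:R = 1 :> R.
        by rewrite (bigD1 i0)//= eqxx big1 ?addr0// => i /negPf ->.
      by rewrite big_split /= -big_distrr /= delta1 mulr1 addrC subrK.
    by move=> i _; rewrite !mxE.
  rewrite mulmxDl -scalemxAl -rowE EA scalerBl scale1r.
  have -> : row i0 (vertex_mx R v) = map_mx (fun n => n%:R) (v i0).
    by apply/rowP => j; rewrite !mxE.
  by rewrite addrCA.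
pose B := S *m toR _ _ U.
have affB : affine_hull (polytope R v) =
    [set map_mx (fun n => n%:R) (v i0) + u *m B | u in [set: 'rV[R]_#|K|]].
  apply/seteqP; split => x.
    move=> /affE[c ->]; exists (c *m toR _ _ L *m toR _ _ Dg *m S^T) => //; congr (_ + _).
    rewrite /B mulmxA SK//; last by move=> k; exact: DgK.
    by rewrite AE !toRM !mulmxA.
  move=> [u _ <-]; apply/affE.
  have [c cE] := DgI (u *m S) (@SK0 u).
  exists (c *m toR _ _ (invmx L)); congr (_ + _).
  by rewrite AE !toRM !mulmxA -[c *m _ *m _]mulmxA VL mulmx1 cE.
exists #|K|, (map_mx (fun n => n%:R) (v i0)), B; split => //.
  apply/row_freeP; exists (toR _ _ (invmx U) *m S^T).
  by rewrite /B mulmxA -[S *m _ *m _]mulmxA UV mulmx1.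
rewrite affB; apply/seteqP; split => x.
  (* The coordinates [u] are recovered from [u *m B] by the inverse of [U], an integer matrix, and a
     selection of columns. *)
  move=> [[u _ <-]] /integer_pointsP xint; exists u => //; apply/integer_pointsP => i.
  have -> : u = (u *m B) *m toR _ _ (invmx U) *m S^T.
    by rewrite /B !mulmxA -[u *m _ *m _ *m _]mulmxA UV mulmx1 -mulmxA SS mulmx1.
  have uB j : (u *m B) ord0 j \is a Num.int.
    have -> : (u *m B) ord0 j = (map_mx (fun n => n%:R) (v i0) + u *m B) ord0 j - (v i0 ord0 j)%:R.
      by rewrite [in RHS]mxE [X in _ = X + _ - _]mxE addrAC subrr add0r.
    by rewrite rpredB// natr_int.
  rewrite mxE; apply: rpred_sum => k _; rewrite !mxE; apply: rpredM; last exact: natr_int.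
  by apply: rpred_sum => l _; apply: rpredM => //; rewrite mxE intr_int.
move=> [u /integer_pointsP uint <-]; split; first by exists u.
apply/integer_pointsP => j; rewrite mxE; apply: rpredD; first by rewrite mxE natr_int.
rewrite mxE; apply: rpred_sum => k _; apply: rpredM => //.
rewrite mxE; apply: rpred_sum => l _; rewrite !mxE.
by apply: rpredM; [exact: natr_int|exact: intr_int].
Qed.

End PolytopeFrame.

(** * The lifting polytope *)

Definition lift_point (R : realType) m s p (v : 'I_m -> 'rV[nat]_s) (e : 'I_p -> 'I_s)
    (t : 'I_m * {set 'I_p}) : 'rV[R]_(s + p) :=
  row_mx (row t.1 (vertex_mx R v))
    (\row_j (if j \in t.2 then (v t.1 ord0 (e j))%:R else 0)).
Arguments lift_point R {m s p} v e t.

Lemma lift_point_int (R : realType) m s p (v : 'I_m -> 'rV[nat]_s) (e : 'I_p -> 'I_s)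
    (t : 'I_m * {set 'I_p}) i : lift_point R v e t ord0 i \is a Num.int.
Proof.
rewrite /lift_point; case: (split_ordP i) => k ->.
  by rewrite row_mxEl !mxE natr_int.
by rewrite row_mxEr mxE; case: ifP; rewrite ?natr_int.
Qed.

Section Lifting.
Variables (R : realType) (m s p : nat) (v : 'I_m -> 'rV[nat]_s) (e : 'I_p -> 'I_s).
Variable i0 : 'I_m.

Let P := polytope R v.
Let V : 'M[R]_(m, s) := vertex_mx R v.
Let w (j : 'I_p) : 'rV[R]_s -> R := coordinate (e j).
Let Q := lifting_polytope v w.

Let lift := lift_point R v e.

Lemma lifting_pointsE : lifting_points v w = range (lift_point R v e).
Proof.
have liftE i (J : {set 'I_p}) : let vi := map_mx (fun n => n%:R) (v i) in
    row_mx vi 0 + \sum_(j in J) w j vi *: delta_mx ord0 (rshift s j) = lift (i, J).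
  move=> vi; rewrite /lift /lift_point /=.
  have -> : row i (vertex_mx R v) = vi by apply/rowP => k; rewrite !mxE.
  rewrite (eq_bigr (fun j => row_mx 0 (w j vi *: delta_mx ord0 j))); last first.
    by move=> j _; rewrite delta_mx_rshift scale_row_mx scaler0.
  rewrite -[X in _ = row_mx X _]addr0 -[X in _ = row_mx _ X]add0r -add_row_mx; congr (_ + _).
  transitivity (row_mx (0 : 'rV[R]_s) (\sum_(j in J) w j vi *: delta_mx ord0 j)).
    elim/big_ind2 : _ => //; first by rewrite row_mx0.
    by move=> ? ? ? ? -> ->; rewrite add_row_mx addr0.
  congr row_mx; apply/rowP => k; rewrite summxE mxE.
  case: ifPn => kJ.
    rewrite (bigD1 k)//= big1 => [|j /andP[_ /negPf jk]].
      by rewrite !mxE !eqxx mulr1 addr0 /w /coordinate mxE.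
    by rewrite !mxE eqxx /= eq_sym jk mulr0.
  rewrite big1// => j jJ; rewrite !mxE eqxx /=; case: eqP => [kj|]; rewrite ?mulr0//.
  by rewrite kj jJ in kJ.
apply/seteqP; split => x.
  by move=> [i [J ->]]; exists (i, J) => //; exact: esym (liftE i J).
by move=> [[i J] _ <-]; exists i, J; exact: esym (liftE i J).
Qed.

Let sum_pair (W : nmodType) (F : 'I_m * {set 'I_p} -> W) :
  \sum_t F t = \sum_i \sum_J F (i, J).
Proof. by rewrite pair_bigA; apply: eq_bigr => -[]. Qed.

Let lsub_combination (c : 'I_m * {set 'I_p} -> R) :
  lsubmx (\sum_t c t *: lift t) = (\row_i \sum_J c (i, J)) *m V.
Proof.
apply/rowP => k; rewrite mxE summxE sum_pair mxE; apply: eq_bigr => i _.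
by rewrite mxE big_distrl; apply: eq_bigr => J _; rewrite mxE row_mxEl mxE.
Qed.

Let rsub_combination (c : 'I_m * {set 'I_p} -> R) j :
  (rsubmx (\sum_t c t *: lift t)) ord0 j =
  \sum_i (\sum_(J : {set 'I_p} | j \in J) c (i, J)) * V i (e j).
Proof.
rewrite mxE summxE sum_pair; apply: eq_bigr => i _.
rewrite big_distrl [RHS]big_mkcond; apply: eq_bigr => J _; rewrite mxE row_mxEr mxE /=.
by case: ifP; rewrite ?mulr0// [V _ _]mxE.
Qed.

Let V_ge0 i j : 0 <= V i j. Proof. by rewrite mxE. Qed.

(** In one direction, [b_j] is a partial sum of the nonnegative sum for [x_(e j)]. Conversely, [b_j]
    is a fraction [t j] of [x_(e j)], and the coefficient of each vertex is distributed over the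
    sets [J] like the law of independent events with probabilities [t j]. *)
Lemma dilate_lifting_polytope n (x : 'rV[R]_s) (b : 'rV[R]_p) :
  dilate n Q (row_mx x b) <->
  dilate n P x /\ forall j, 0 <= b ord0 j <= x ord0 (e j).
Proof.
rewrite /Q /lifting_polytope lifting_pointsE; split.
  move=> /(dilate_convex_hull _ (i0, finset.set0))[c [c0 cn xbE]].
  have xE : x = (\row_i \sum_J c (i, J)) *m V.
    by rewrite -lsub_combination -xbE row_mxKl.
  split.
    apply/(dilate_polytope v i0); exists (\row_i \sum_J c (i, J)); split => //.
      by move=> i; rewrite mxE sumr_ge0.
    by rewrite -cn sum_pair; apply: eq_bigr => i _; rewrite mxE.
  move=> j; have -> : b ord0 j = \sum_i (\sum_(J : {set 'I_p} | j \in J) c (i, J)) * V i (e j).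
    by rewrite -rsub_combination -xbE row_mxKr.
  rewrite sumr_ge0 /= => [|i _]; last by rewrite mulr_ge0// sumr_ge0.
  rewrite xE mxE ler_sum// => i _; rewrite [(\row_i _) _ _]mxE ler_wpM2r//.
  by rewrite [leRHS](bigID (fun J : {set 'I_p} => j \in J)) /= lerDl sumr_ge0.
move=> [/(dilate_polytope v i0)[l [l0 ln xE]] bx].
(* If [x_(e j) = 0] then [b_j = 0] too, and division by zero gives the fraction [0]. *)
pose t j := b ord0 j / x ord0 (e j).
have tx j : x ord0 (e j) * t j = b ord0 j.
  rewrite /t; have [x0|x0] := eqVneq (x ord0 (e j)) 0; last by rewrite mulrC divfK.
  by rewrite x0 mul0r; apply/esym/eqP; rewrite eq_le; have := bx j; rewrite x0 andbC.
have t01 j : 0 <= t j <= 1.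
  have /andP[b0 bxj] := bx j; have x0 := le_trans b0 bxj.
  rewrite /t divr_ge0//=; move: x0; rewrite le_eqVlt => /predU1P[<-|x0].
    by rewrite invr0 mulr0.
  by rewrite ler_pdivrMr// mul1r.
pose tau (J : {set 'I_p}) := \prod_j (if j \in J then t j else 1 - t j).
have tau1 : \sum_J tau J = 1.
  by rewrite -bigA_distr big1// => j _; rewrite /= addrC subrK.
have tauj j : \sum_(J : {set 'I_p} | j \in J) tau J = t j.
  (* The factor [(k != j)%:R] kills exactly the sets that miss [j]. *)
  transitivity (\sum_(J : {set 'I_p}) \prod_k (if k \in J then t k else (1 - t k) * (k != j)%:R)).
    rewrite big_mkcond; apply: eq_bigr => J _; case: ifPn => jJ.
      apply: eq_bigr => k _; case: ifPn => // kJ.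
      by rewrite (_ : k != j) ?mulr1//; apply: contraNneq kJ => ->.
    by rewrite (bigD1 j)//= (negPf jJ) eqxx mulr0 mul0r.
  rewrite -bigA_distr (bigD1 j)//= eqxx mulr0 addr0 big1 ?mulr1// => k kj /=.
  by rewrite kj mulr1 addrC subrK.
apply/(dilate_convex_hull _ (i0, finset.set0)).
exists (fun iJ => l ord0 iJ.1 * tau iJ.2).
have sJ i : \sum_J l ord0 i * tau J = l ord0 i by rewrite -big_distrr /= tau1 mulr1.
split.
- move=> [i J] /=; rewrite mulr_ge0// prodr_ge0// => j _.
  by have /andP[t0 t1] := t01 j; case: ifP; rewrite ?subr_ge0.
- by rewrite sum_pair -ln; apply: eq_bigr => i _; exact: sJ.
- rewrite -[RHS]hsubmxK; congr row_mx.
    rewrite lsub_combination xE; congr (_ *m _); apply/rowP => i.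
    by rewrite mxE /= sJ.
  apply/rowP => j; rewrite rsub_combination -tx xE mxE big_distrl.
  by apply: eq_bigr => i _ /=; rewrite -big_distrr /= tauj mulrAC.
Qed.

Hypothesis V_neq0 : forall j, exists i, V i (e j) != 0.

(** At a vertex [i] whose coordinate [e j] is nonzero, the lifts for [J = {j}] and for empty [J]
    differ by a nonzero multiple of the [j]-th new unit vector. Hence the hull is closed under
    translation in every new direction. *)
Lemma affine_hull_lifting_polytope (x : 'rV[R]_s) (b : 'rV[R]_p) :
  affine_hull Q (row_mx x b) <-> affine_hull P x.
Proof.
rewrite /Q /lifting_polytope lifting_pointsE affine_hull_convex_hull; split.
  move=> /affine_hull_range[c [c1 xbE]].
  apply/affine_hull_polytope; exists (\row_i \sum_J c (i, J)).
  split; first by rewrite -c1 sum_pair; apply: eq_bigr => i _; rewrite mxE.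
  by rewrite -lsub_combination -xbE row_mxKl.
have shift (y : 'rV[R]_(s + p)) a t t' : affine_hull (range lift) y ->
    affine_hull (range lift) (y + a *: (lift t - lift t')).
  move=> /affine_hull_range[c [c1 ->]]; apply/affine_hull_range.
  have sum1 t0 : \sum_t1 (t1 == t0)%:R = 1 :> R.
    by rewrite (bigD1 t0)//= eqxx big1 ?addr0// => t1 /negPf ->.
  have sumf t0 : \sum_t1 (t1 == t0)%:R *: lift t1 = lift t0.
    rewrite (bigD1 t0)//= eqxx scale1r big1 ?addr0// => t1 /negPf ->.
    by rewrite scale0r.
  exists (fun t1 => c t1 + a * ((t1 == t)%:R - (t1 == t')%:R)); split.
    by rewrite big_split /= c1 -big_distrr /= sumrB !sum1 subrr mulr0 addr0.
  under [RHS]eq_bigr do rewrite scalerDl -scalerA scalerBl.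
  by rewrite big_split /= -scaler_sumr sumrB !sumf.
move=> /affine_hull_polytope[c [c1 xE]].
have x0 : affine_hull (range lift) (row_mx x 0).
  apply/affine_hull_range; exists (fun t => c ord0 t.1 * (t.2 == finset.set0)%:R).
  have sJ i : \sum_(J : {set 'I_p}) c ord0 i * (J == finset.set0)%:R = c ord0 i.
    rewrite -big_distrr /= (bigD1 finset.set0)//= eqxx big1 ?addr0 ?mulr1//.
    by move=> J /negPf ->.
  split; first by rewrite sum_pair; apply: etrans c1; apply: eq_bigr => i _; exact: sJ.
  rewrite -[RHS]hsubmxK; congr row_mx.
    rewrite lsub_combination xE; congr (_ *m _); apply/rowP => i.
    by rewrite mxE /= sJ.
  apply/rowP => j; rewrite rsub_combination mxE big1// => i _.
  rewrite big1 ?mul0r// => J jJ /=; case: eqP => [J0|]; rewrite ?mulr0//.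
  by rewrite J0 inE in jJ.
rewrite -[b]mulmx1 mulmx_sum_row.
elim: (index_enum _) => [|j r IH]; first by rewrite big_nil.
rewrite big_cons; have [i Vi] := V_neq0 j.
set S := \sum_(_ <- _) _ in IH *.
suff -> : row_mx x (b ord0 j *: row j 1%:M + S) = row_mx x S +
    (b ord0 j / V i (e j)) *: (lift (i, [set j]%SET) - lift (i, finset.set0)).
  exact: shift.
rewrite /lift /lift_point /= opp_row_mx add_row_mx subrr scale_row_mx add_row_mx.
rewrite scaler0 addr0 addrC; congr row_mx; congr (_ + _); apply/rowP => k.
rewrite !mxE !inE subr0 [j == k]eq_sym; case: eqP => [->|_]; last by rewrite !mulr0.
by rewrite mulr1 divfK//; move: Vi; rewrite mxE.
Qed.

Lemma lifting_lattice_frame d (x0 : 'rV[R]_s) (B : 'M[R]_(d, s)) :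
  lattice_frame P x0 B ->
  lattice_frame Q (row_mx x0 0) (block_mx B 0 0 1%:M : 'M[R]_(d + p, s + p)).
Proof.
move=> [/row_freeP[C BC] affP intP].
have img (u : 'rV[R]_d) (b : 'rV[R]_p) :
    row_mx x0 0 + row_mx u b *m block_mx B 0 0 1%:M = row_mx (x0 + u *m B) b.
  by rewrite mul_row_block !mulmx0 mulmx1 addr0 add0r add_row_mx add0r.
have int_row k l (x : 'rV[R]_k) (b : 'rV[R]_l) : integer_points R _ (row_mx x b) <->
    integer_points R _ x /\ integer_points R _ b.
  split=> [/integer_pointsP h|[/integer_pointsP hx /integer_pointsP hb]].
    split; apply/integer_pointsP => i.
      by have := h (lshift _ i); rewrite row_mxEl.
    by have := h (rshift _ i); rewrite row_mxEr.
  apply/integer_pointsP => i; case: (split_ordP i) => j ->.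
    by rewrite row_mxEl.
  by rewrite row_mxEr.
split.
- apply/row_freeP; exists (block_mx C 0 0 1%:M).
  by rewrite mulmx_block !mul0mx !mulmx0 !addr0 add0r BC mulmx1 -scalar_mx_block.
- apply/seteqP; split => z.
    rewrite -[z]hsubmxK => /affine_hull_lifting_polytope.
    rewrite affP => -[u _ <-]; exists (row_mx u (rsubmx z)) => //; exact: img.
  move=> [u _ <-]; rewrite -[u]hsubmxK img; apply/affine_hull_lifting_polytope.
  by rewrite affP; exists (lsubmx u).
- apply/seteqP; split => z.
    rewrite -[z]hsubmxK => -[/affine_hull_lifting_polytope affz /int_row[intz intb]].
    have : (affine_hull P `&` integer_points R s) (lsubmx z) by [].
    rewrite intP => -[u uint <-]; exists (row_mx u (rsubmx z)); last exact: img.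
    exact/int_row.
  move=> [u + <-]; rewrite -[u]hsubmxK => /int_row[intu intb]; rewrite img.
  have [affu intx] : (affine_hull P `&` integer_points R s) (x0 + lsubmx u *m B).
    by rewrite intP; exists (lsubmx u).
  by split; [exact/affine_hull_lifting_polytope|exact/int_row].
Qed.

End Lifting.

(** * Lebesgue measure of unions of grid boxes *)

(** The integral of a nonnegative function is a supremum over the simple functions below it, and a
    larger function admits more of them. This lets arbitrary regions be compared with unions of
    boxes. *)
Lemma ge0_le_integral_nonmeasurable d (T : measurableType d) (R : realType)
    (mu : {measure set T -> \bar R}) (f g : T -> \bar R) :
  (forall x, 0 <= f x)%E -> (forall x, f x <= g x)%E ->
  (\int[mu]_x f x <= \int[mu]_x g x)%E.
Proof.
move=> f0 fg; have g0 x : (0 <= g x)%E by exact: le_trans (f0 x) (fg x).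
rewrite !ge0_integralTE//; apply: le_ereal_sup => _ [h hf <-].
by exists h => // x; exact: le_trans (hf x) (fg x).
Qed.

Lemma iter_lebesgue_ge0 (R : realType) N (A : set (iterR R N)) :
  (0 <= iter_lebesgue A)%E.
Proof.
elim: N A => [|N IH] A //=.
by apply: integral_ge0 => x _ /=.
Qed.

Lemma le_iter_lebesgue (R : realType) N (A B : set (iterR R N)) :
  A `<=` B -> (iter_lebesgue A <= iter_lebesgue B)%E.
Proof.
elim: N A B => [|N IH] A B AB /=.
  rewrite /dirac /= lee_fin !indicE ler_nat.
  by case: (boolP (tt \in A)) => // /set_mem/AB/mem_set ->.
apply: ge0_le_integral_nonmeasurable => x /=; first exact: iter_lebesgue_ge0.
by apply: IH => y; rewrite /xsection /= !inE; exact: AB.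
Qed.

Section ProductMeasure.
Context d1 d2 (T1 : measurableType d1) (T2 : measurableType d2) (R : realType).
Variables (m1 : {sigma_finite_measure set T1 -> \bar R})
          (m2 : {sigma_finite_measure set T2 -> \bar R}).

(* An alias: on [m1 \x m2] itself, inference picks the instance for
   subprobabilities. *)
Definition sigma_finite_product : set (T1 * T2) -> \bar R := (m1 \x m2)%E.

HB.instance Definition _ := Measure.copy sigma_finite_product (m1 \x m2)%E.

Let sigma_finite_productT : sigma_finite setT sigma_finite_product.
Proof.
have := isSigmaFinite.sigma_finiteT
  (lebesgue_integral_fubini.measure_function_Measure_isSigmaFinite__to__measure_function_isSigmaFinite m1 m2).
exact.
Qed.

HB.instance Definition _ :=
  Measure_isSigmaFinite.Build _ _ _ sigma_finite_product sigma_finite_productT.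

End ProductMeasure.

(** Gives access to additivity on grid boxes; sigma-finiteness carries the induction through
    products. *)
Lemma iter_lebesgue_measure (R : realType) N :
  exists mu : {sigma_finite_measure set iterR R N -> \bar R},
    @iter_lebesgue R N = mu :> (set _ -> \bar R).
Proof.
elim: N => [|N [mu IH]] /=.
  by exists [the {sigma_finite_measure set _ -> \bar R} of \d_(tt:unit)].
rewrite IH.
by exists [the {sigma_finite_measure set _ -> \bar R} of
  sigma_finite_product (@lebesgue_measure R) mu].
Qed.

(** Half-open cubes, so that those of one size partition the space. *)
Definition grid_box (R : realType) N (n : nat) (a : 'rV[int]_N) : set 'rV[R]_N :=
  [set x | forall i, (a ord0 i)%:~R <= n%:R * x ord0 i < (a ord0 i)%:~R + 1].
Arguments grid_box R {N} n a.

Lemma grid_box_disjoint (R : realType) N n (a b : 'rV[int]_N) x :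
  grid_box R n a x -> grid_box R n b x -> a = b.
Proof.
move=> xa xb; apply/rowP => i.
have /andP[a1 a2] := xa i; have /andP[b1 b2] := xb i.
have := le_lt_trans a1 b2; have := le_lt_trans b1 a2.
rewrite -!(intrD _ _ 1) !ltr_int !ltzD1 => ba ab.
by apply/eqP; rewrite eq_le ab ba.
Qed.

Lemma grid_boxS (R : realType) N n (a : 'rV[int]_(1 + N)) : (0 < n)%N ->
  @row_of_iter R (1 + N) @^-1` grid_box R n a =
  `[(a ord0 ord0)%:~R / n%:R, ((a ord0 ord0)%:~R + 1) / n%:R[%classic `*`
  (@row_of_iter R N @^-1` grid_box R n (rsubmx a)).
Proof.
move=> n0; have n0' : 0 < n%:R :> R by rewrite ltr0n.
have e : lshift N ord0 = ord0 :> 'I_(1 + N) by apply: val_inj.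
apply/seteqP; split => -[x y].
- move=> /= h; split => [|i]; rewrite /= ?in_itv /=.
    have := h (lshift N ord0); rewrite row_mxEl e mxE eqxx mulr1n.
    by rewrite ler_pdivrMr// ltr_pdivlMr// mulrC.
  by have := h (rshift 1 i); rewrite row_mxEr mxE.
- move=> [/=]; rewrite in_itv /= => h1 h2 i /=.
  case: (split_ordP i) => j ->; rewrite ?(row_mxEl, row_mxEr).
    rewrite (ord1 j) e mxE eqxx mulr1n.
    by move: h1; rewrite ler_pdivrMr// ltr_pdivlMr// mulrC.
  by have := h2 j; rewrite mxE.
Qed.

Lemma measurable_grid_box (R : realType) N n (a : 'rV[int]_N) : (0 < n)%N ->
  measurable (@row_of_iter R N @^-1` grid_box R n a).
Proof.
move=> n0; elim: N a => [|N IH] a.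
  rewrite (_ : _ @^-1` _ = setT); first exact: measurableT.
  by apply/seteqP; split => // x _ [].
rewrite (grid_boxS _ (a : 'rV_(1 + N)))//.
by apply: measurableX => //; exact: IH.
Qed.

Lemma volume_grid_box (R : realType) N n (a : 'rV[int]_N) : (0 < n)%N ->
  volume (grid_box R n a) = (n%:R ^- N)%:E.
Proof.
move=> n0; have n0' : 0 < n%:R :> R by rewrite ltr0n.
rewrite /volume; elim: N a => [|N IH] a.
  rewrite expr0 invr1 /= (_ : _ @^-1` _ = setT) ?diracT//.
  by apply/seteqP; split => // x _ [].
rewrite (grid_boxS _ (a : 'rV_(1 + N)))//=.
have [mu muE] := iter_lebesgue_measure R N.
have := IH (rsubmx (a : 'rV_(1 + N))); rewrite muE => IHa.
rewrite product_measure1E//; last exact: measurable_grid_box.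
rewrite IHa exprS invfM EFinM; congr (_ * _)%E.
apply: etrans (lebesgue_measure_itv _) _.
rewrite /= lte_fin ltr_pM2r ?invr_gt0// ltrDl ltr01.
by rewrite -EFinB mulrDl addrAC subrr add0r mul1r.
Qed.

Lemma volume_grid_le (R : realType) N n (s : seq 'rV[int]_N) (A : set 'rV[R]_N) :
  (0 < n)%N -> (forall x, A x -> exists2 a, a \in s & grid_box R n a x) ->
  (volume A <= ((size s)%:R / n%:R ^+ N)%:E)%E.
Proof.
move=> n0 As.
pose F (a : 'rV[int]_N) := @row_of_iter R N @^-1` grid_box R n a.
apply: (@le_trans _ _ (iter_lebesgue (\big[setU/set0]_(a <- s) F a))).
  apply: le_iter_lebesgue => x /= /As[a a_s xa].
  by rewrite -bigcup_seq; exists a.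
have [mu muE] := iter_lebesgue_measure R N; rewrite muE {As}.
elim: s => [|a s IH]; first by rewrite big_nil measure0 mul0r.
rewrite big_cons; apply: le_trans (measureU2 _ _ _) _.
- exact: measurable_grid_box.
- by apply: bigsetU_measurable => b _; exact: measurable_grid_box.
rewrite /= -natr1 mulrDl mul1r addrC EFinD leeD// .
by rewrite -(volume_grid_box R a n0) /volume muE.
Qed.

Lemma volume_grid_ge (R : realType) N n (s : seq 'rV[int]_N) (A : set 'rV[R]_N) :
  (0 < n)%N -> uniq s -> (forall a, a \in s -> grid_box R n a `<=` A) ->
  (((size s)%:R / n%:R ^+ N)%:E <= volume A)%E.
Proof.
move=> n0 us sA.
pose F (a : 'rV[int]_N) := @row_of_iter R N @^-1` grid_box R n a.
apply: (@le_trans _ _ (iter_lebesgue (\big[setU/set0]_(a <- s) F a))); last first.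
  apply: le_iter_lebesgue => x /=.
  by rewrite -bigcup_seq => -[a /= a_s xa]; exact: sA xa.
have [mu muE] := iter_lebesgue_measure R N; rewrite muE {sA}.
elim: s us => [|a s IH] /=; first by rewrite big_nil measure0 mul0r.
move=> /andP[aNs us]; rewrite big_cons measureU.
- rewrite /= -natr1 mulrDl mul1r addrC EFinD leeD ?IH//.
  by rewrite -(volume_grid_box R a n0) /volume muE.
- exact: measurable_grid_box.
- by apply: bigsetU_measurable => b _; exact: measurable_grid_box.
- apply/seteqP; split => // x [xa]; rewrite -bigcup_seq => -[b /= bs xb].
  by move: aNs; rewrite (grid_box_disjoint xa xb) bs.
Qed.

(** * Comparison of the count with the volume *)

Lemma integer_box_points (R : realType) p (c : 'I_p -> nat) :
  exists t : seq 'rV[R]_p, [/\ uniq t, size t = (\prod_j c j)%N &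
    forall b : 'rV[R]_p, (b \in t) <->
      integer_points R p b /\ forall j, 0 <= b ord0 j < (c j)%:R].
Proof.
pose M := (\sum_j c j).+1.
have cM j : (c j < M)%N by rewrite ltnS (bigD1 j)//= leq_addr.
pose F (j : 'I_p) : pred 'I_M := fun k => (k < c j)%N.
pose g (f : {ffun 'I_p -> 'I_M}) : 'rV[R]_p := \row_j (f j)%:R.
exists [seq g f | f <- enum (family F)]; split.
- rewrite map_inj_uniq ?enum_uniq// => f f' /rowP ff'; apply/ffunP => j; apply/val_inj.
  by have /eqP := ff' j; rewrite !mxE eqr_nat => /eqP.
- rewrite size_map -cardE card_family foldrE big_map big_enum /=.
  apply: eq_bigr => j _.
  rewrite -[RHS](card_ord (c j)) -(fintype.card_image (f := widen_ord (ltnW (cM j)))); last first.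
    by move=> x y /(congr1 val) /= /val_inj.
  apply: fintype.eq_card => k; apply/idP/fintype.imageP => [kc|[l _ ->]]; last exact: (ltn_ord l).
  by exists (Ordinal kc) => //; apply: val_inj.
- move=> b; split.
    move=> /mapP[f + ->]; rewrite mem_enum => /familyP fF; split.
      by apply/integer_pointsP => j; rewrite mxE natr_int.
    by move=> j; rewrite mxE ler0n ltr_nat; exact: fF.
  move=> [/integer_pointsP bint bc].
  have /choice[k kE] : forall j, exists k : 'I_M, b ord0 j = k%:R.
    move=> j; have /andP[b0 bj] := bc j.
    have /natrP[l lE] : b ord0 j \is a Num.nat by rewrite natrEint bint.
    have lc : (l < c j)%N by rewrite -(ltr_nat R) -lE.
    by exists (Ordinal (ltn_trans lc (cM j))).
  apply/mapP; exists [ffun j => k j]; last by apply/rowP => j; rewrite mxE ffunE.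
  rewrite mem_enum; apply/familyP => j; rewrite ffunE.
  by have /andP[_] := bc j; rewrite kE ltr_nat.
Qed.

Section Sandwich.
Variables (R : realType) (m s p : nat) (v : 'I_m -> 'rV[nat]_s) (e : 'I_p -> 'I_s).
Variable i0 : 'I_m.

Let P := polytope R v.
Let V : 'M[R]_(m, s) := vertex_mx R v.
Let w (j : 'I_p) : 'rV[R]_s -> R := coordinate (e j).
Let Q := lifting_polytope v w.
Let E n := weighted_ehrhart P w n.

(* [E n] is the number of these points: over [a] there are [prod_j a_(e j)]. *)
Let subgraph n (z : 'rV[R]_(s + p)) : Prop :=
  [/\ dilate n P (lsubmx z), integer_points R _ (lsubmx z),
      integer_points R _ (rsubmx z) &
      forall j, 0 <= rsubmx z ord0 j < lsubmx z ord0 (e j)].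

Let dilate_ge0 n a i : dilate n P a -> 0 <= a ord0 i.
Proof.
move=> /(dilate_polytope v i0)[x [x0 _ ->]]; rewrite mxE sumr_ge0// => k _.
by rewrite mulr_ge0// mxE.
Qed.

Let dilate_lattice_nat n a i : dilate n P a -> integer_points R _ a ->
  a ord0 i = (Num.truncn (a ord0 i))%:R.
Proof.
move=> aP /integer_pointsP aint; apply/esym/eqP; rewrite -natrEtruncn natrEint aint.
exact: dilate_ge0 aP.
Qed.

Lemma subgraph_points n : exists t : seq 'rV[R]_(s + p),
  [/\ uniq t, E n = (size t)%:R & forall z, z \in t <-> subgraph n z].
Proof.
have [r ru rE] := finite_lattice_points R v i0 n.
have /choice[t tP] := fun a : 'rV[R]_s =>
  integer_box_points R (fun j => Num.truncn (a ord0 (e j))).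
have rP a : a \in r <-> dilate n P a /\ integer_points R _ a.
  split=> [ar|h]; first by have : [set` r] a by []; rewrite -rE.
  by have : [set` r] a by rewrite -rE.
exists [seq row_mx a b | a <- r, b <- t a]; split.
- apply: allpairs_uniq_dep => //; first by move=> a _; case: (tP a).
  by move=> [a b] [a' b'] _ _ /= /eq_row_mx[-> ->].
- rewrite size_allpairs_dep sumnE big_map /E /weighted_ehrhart rE -fsbig_seq// natr_sum.
  rewrite !big_seq; apply: eq_bigr => a /rP[aP aint].
  have [_ -> _] := tP a; rewrite natr_prod; apply: eq_bigr => j _.
  by rewrite -(dilate_lattice_nat _ aP).
- move=> z; split.
    move=> /allpairsPdep[a [b [/rP[aP aint] bt ->]]]; rewrite /subgraph row_mxKl row_mxKr.
    have [_ _ /(_ b)/iffLR/(_ bt)[bint bc]] := tP a; split => // j.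
    by rewrite (dilate_lattice_nat _ aP).
  move=> [zP zint bint bz]; apply/allpairsPdep; exists (lsubmx z), (rsubmx z).
  split; [exact/rP| |by rewrite hsubmxK].
  have [_ _ ->] := tP (lsubmx z); split => // j.
  by rewrite -(dilate_lattice_nat _ zP).
Qed.

Let subgraph_dilate n z : subgraph n z -> dilate n Q z /\ integer_points R _ z.
Proof.
move=> [zP /integer_pointsP zint /integer_pointsP bint bz]; split.
  rewrite -[z]hsubmxK; apply/(dilate_lifting_polytope v e i0); split => // j.
  by have /andP[-> /ltW] := bz j.
apply/integer_pointsP => i; rewrite -[z]hsubmxK; case: (split_ordP i) => k ->.
  by rewrite row_mxEl.
by rewrite row_mxEr.
Qed.

Hypothesis V_neq0 : forall j, exists i, V i (e j) != 0.

(** A lattice point of the [m]-th dilate at which every weight is at least [1], as each weight is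
    nonzero at some vertex. *)
Let y1 : 'rV[R]_s := const_mx 1 *m V.

Let y1_int : integer_points R _ y1.
Proof.
apply/integer_pointsP => i; rewrite mxE; apply: rpred_sum => k _.
by rewrite !mxE mul1r natr_int.
Qed.

Let y1_dilate : dilate m P y1.
Proof.
apply/(dilate_polytope v i0); exists (const_mx 1); split => //.
  by move=> i; rewrite mxE.
by under eq_bigr do rewrite mxE; rewrite sumr_const card_ord.
Qed.

Let y1_ge1 j : 1 <= y1 ord0 (e j).
Proof.
have [i Vi] := V_neq0 j; rewrite mxE (bigD1 i)//= ler_wpDr//.
  by rewrite sumr_ge0// => k _; rewrite !mxE mul1r.
by move: Vi; rewrite !mxE mul1r pnatr_eq0 -lt0n ler1n.
Qed.

Let dilate_polytopeD n n' a a' : dilate n P a -> dilate n' P a' ->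
  dilate (n + n') P (a + a').
Proof.
move=> /(dilate_polytope v i0)[x [x0 xn ->]] /(dilate_polytope v i0)[x' [x0' xn' ->]].
apply/(dilate_polytope v i0); exists (x + x'); split.
- by move=> i; rewrite mxE addr_ge0.
- by under eq_bigr do rewrite mxE; rewrite big_split /= xn xn' natrD.
- by rewrite mulmxDl.
Qed.

Let dilate_liftD n n' z z' : dilate n Q z -> dilate n' Q z' ->
  dilate (n + n') Q (z + z').
Proof.
rewrite -[z]hsubmxK -[z']hsubmxK.
move: (lsubmx z) (rsubmx z) (lsubmx z') (rsubmx z') => a b a' b'.
move=> /(dilate_lifting_polytope v e i0)[aP ba] /(dilate_lifting_polytope v e i0)[aP' ba'].
rewrite add_row_mx; apply/(dilate_lifting_polytope v e i0); split.
  exact: dilate_polytopeD.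
move=> j; have /andP[b0 bj] := ba j; have /andP[b0' bj'] := ba' j.
by rewrite !mxE addr_ge0 ?lerD.
Qed.

(* Moving up by the sum of the vertices makes every weight strictly bigger. *)
Let dilate_subgraph n z : dilate n Q z -> integer_points R _ z ->
  subgraph (n + m) (z + row_mx y1 0).
Proof.
rewrite -[z]hsubmxK => /(dilate_lifting_polytope v e i0)[aP ba] /integer_pointsP zint.
rewrite add_row_mx addr0 /subgraph row_mxKl row_mxKr; split.
- exact: dilate_polytopeD.
- apply/integer_pointsP => i; rewrite mxE; apply: rpredD; last by move/integer_pointsP: y1_int.
  by have := zint (lshift _ i); rewrite row_mxEl.
- by apply/integer_pointsP => i; have := zint (rshift _ i); rewrite row_mxEr.
- move=> j; have /andP[-> bj] := ba j; rewrite [ltRHS]mxE /=.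
  by rewrite (le_lt_trans bj)// ltrDl (lt_le_trans ltr01).
Qed.

(** The point [(y1, 0)] is counted. Through the lower bound of the sandwich this makes the volume
    positive. *)
Lemma weighted_ehrhart_gt0 : 0 < E m.
Proof.
have [t [_ -> tP]] := subgraph_points m; rewrite ltr0n.
suff : row_mx y1 0 \in t by case: t {tP}.
apply/tP; rewrite /subgraph row_mxKl row_mxKr; split => //.
  by apply/integer_pointsP => i; rewrite mxE.
by move=> j; rewrite mxE lexx (lt_le_trans ltr01).
Qed.

Variables (N : nat) (x0 : 'rV[R]_(s + p)) (B : 'M[R]_(N, s + p)).
Hypothesis frame : lattice_frame Q x0 B.

Let B_free : row_free B. Proof. by case: frame. Qed.

Let affQ : affine_hull Q = [set x0 + u *m B | u in [set: 'rV[R]_N]].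
Proof. by case: frame. Qed.

Let intQ : affine_hull Q `&` integer_points R _ =
  [set x0 + u *m B | u in integer_points R N].
Proof. by case: frame. Qed.

Let Q_aff : Q `<=` affine_hull Q.
Proof.
move=> z Qz; exists 1%N, (fun=> z), (fun=> 1); split => //.
  by rewrite big_ord1.
by rewrite big_ord1 scale1r.
Qed.

Let toR (u : 'rV[int]_N) : 'rV[R]_N := map_mx intr u.

Let frame_int (u : 'rV[R]_N) : integer_points R _ u -> integer_points R _ (x0 + u *m B).
Proof.
move=> uint; have : (affine_hull Q `&` integer_points R _) (x0 + u *m B).
  by rewrite intQ; exists u.
by case.
Qed.

Let x0_int : integer_points R _ x0.
Proof.
have := @frame_int 0; rewrite mul0mx addr0; apply.
by apply/integer_pointsP => i; rewrite mxE.
Qed.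

Let uB_int (u : 'rV[R]_N) : integer_points R _ u -> integer_points R _ (u *m B).
Proof.
move=> /frame_int/integer_pointsP h; apply/integer_pointsP => i.
have /integer_pointsP x0i := x0_int.
by have := rpredB (h i) (x0i i); rewrite mxE addrAC subrr add0r.
Qed.

(** Subtracting the integer vector [(n - 1) x0] moves a point of the dilate into the affine hull of
    [Q], where the frame applies. *)
Let frame_coordinates n z : (0 < n)%N -> dilate n Q z -> integer_points R _ z ->
  exists u : 'rV[int]_N, z = n%:R *: x0 + toR u *m B.
Proof.
move=> n0 [q Qq <-] /integer_pointsP zint.
have := Q_aff Qq; rewrite affQ => -[u _ qE].
have : (affine_hull Q `&` integer_points R _) (x0 + (n%:R *: u) *m B).
  split; first by rewrite affQ; exists (n%:R *: u).
  apply/integer_pointsP => i.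
  have -> : x0 + (n%:R *: u) *m B = n%:R *: q - (n%:R - 1) *: x0.
    rewrite -qE scalerDr -scalemxAl scalerBl scale1r opprB.
    by rewrite [X in _ = X + _]addrC -addrA [X in _ = _ + X]addrCA subrr addr0 addrC.
  rewrite mxE [X in _ + X]mxE [X in _ - X]mxE; apply: rpredB; first exact: zint.
  apply: rpredM; first by apply: rpredB; [exact: natr_int|exact: rpred1].
  by have /integer_pointsP := x0_int.
rewrite intQ => -[_ [u' _ <-]] /addrI /(row_free_inj B_free) u'E.
by exists u'; rewrite -qE scalerDr scalemxAl -u'E.
Qed.

(** Each row of [B] combines the lifting points with coefficients [mu i] of sum [0]. Starting from
    [M] times the sum of all lifting points, with [M] above every [\sum_i |mu i t|], moves with
    parameters in the unit cube keep the coefficients nonnegative. *)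
Let cube_in_dilate : exists2 c : nat, (0 < c)%N & exists y : 'rV[int]_N, forall t : 'rV[R]_N,
  (forall i, 0 <= t ord0 i <= 1) ->
  dilate c Q (c%:R *: x0 + (toR y + t) *m B).
Proof.
have QE (z : 'rV[R]_(s + p)) k : dilate k Q z <-> exists x : 'I_m * {set 'I_p} -> R,
    [/\ forall t, 0 <= x t, \sum_t x t = k%:R & z = \sum_t x t *: lift_point R v e t].
  by rewrite /Q /lifting_polytope lifting_pointsE; exact: (dilate_convex_hull _ (i0, finset.set0)).
have affE (z : 'rV[R]_(s + p)) : affine_hull Q z <-> exists x : 'I_m * {set 'I_p} -> R,
    \sum_t x t = 1 /\ z = \sum_t x t *: lift_point R v e t.
  by rewrite /Q /lifting_polytope lifting_pointsE affine_hull_convex_hull; exact: affine_hull_range.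
pose T := ('I_m * {set 'I_p})%type.
have [c0 [c01 x0E]] : exists x : T -> R,
    \sum_t x t = 1 /\ x0 = \sum_t x t *: lift_point R v e t.
  by apply/affE; rewrite affQ; exists 0 => //; rewrite mul0mx addr0.
have /choice[mu muP] : forall i : 'I_N, exists x : T -> R,
    \sum_t x t = 0 /\ row i B = \sum_t x t *: lift_point R v e t.
  move=> i; have [|x [x1 xE]] := (affE (x0 + row i B)).1.
    by rewrite affQ; exists (delta_mx ord0 i) => //; rewrite rowE.
  exists (fun t => x t - c0 t); split; first by rewrite sumrB x1 c01 subrr.
  under eq_bigr do rewrite scalerBl.
  by rewrite sumrB -xE -x0E addrAC subrr add0r.
pose M : nat := (\sum_t Num.truncn (\sum_i `|mu i t|)).+1.
have muM t : \sum_i `|mu i t| <= M%:R.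
  apply: le_trans (ltW (truncnS_gt _)) _.
  by rewrite ler_nat ltnS (bigD1 t)//= leq_addr.
pose z0 := \sum_t M%:R *: lift_point R v e t.
pose c := (#|{: T}| * M)%N.
have c_gt0 : (0 < c)%N.
  by rewrite muln_gt0 andbT; apply/card_gt0P; exists (i0, finset.set0).
have cE : \sum_(t : T) M%:R = c%:R :> R.
  by rewrite sumr_const /c mulnC natrM mulr_natr.
have z0Q : dilate c Q z0 by apply/QE; exists (fun=> M%:R); split.
have z0int : integer_points R _ z0.
  apply/integer_pointsP => i; rewrite summxE; apply: rpred_sum => t _.
  by rewrite mxE rpredM ?natr_int// lift_point_int.
have [y yE] := frame_coordinates c_gt0 z0Q z0int.
exists c => //; exists y => t t01; apply/QE.
have tB : t *m B = \sum_t' (\sum_i t ord0 i * mu i t') *: lift_point R v e t'.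
  rewrite mulmx_sum_row; under [RHS]eq_bigr do rewrite scaler_suml.
  rewrite exchange_big /=; apply: eq_bigr => i _.
  by rewrite (muP i).2 scaler_sumr; apply: eq_bigr => t' _; rewrite scalerA.
exists (fun t' => M%:R + \sum_i t ord0 i * mu i t'); split.
- move=> t'; rewrite -lerBlDr sub0r; apply: le_trans (muM t').
  rewrite -sumrN; apply: ler_sum => i _; have /andP[ti0 ti1] := t01 i.
  apply: le_trans (ler_norm _) _; rewrite normrN normrM ger0_norm//.
  by rewrite ler_piMl.
- rewrite big_split /= cE exchange_big /= big1 ?addr0// => i _.
  by rewrite -big_distrr /= (muP i).1 mulr0.
- under [RHS]eq_bigr do rewrite scalerDl.
  by rewrite big_split /= -tB -/z0 yE mulmxDl addrA.
Qed.

Let toRD (a b : 'rV[int]_N) : toR (a + b) = toR a + toR b.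
Proof. by apply/rowP => i; rewrite !mxE intrD. Qed.

Let toR_inj : injective toR.
Proof.
by move=> a b /rowP ab; apply/rowP => i; have := ab i; rewrite !mxE => /intr_inj.
Qed.

Let frame_inj (z : 'rV[R]_(s + p)) (a b : 'rV[int]_N) :
  z + toR a *m B = z + toR b *m B -> a = b.
Proof. by move=> /addrI/(row_free_inj B_free)/toR_inj. Qed.

Let toR_int (a : 'rV[int]_N) : integer_points R _ (toR a).
Proof. by exists a. Qed.

Let dilate_inv n q : (0 < n)%N -> dilate n Q (n%:R *: q) -> Q q.
Proof.
move=> n0 [q' Qq' /(congr1 ( *:%R n%:R^-1))].
by rewrite !scalerA mulVf ?pnatr_eq0 -?lt0n// !scale1r => <-.
Qed.

Let K : set 'rV[R]_N := [set u | Q (x0 + u *m B)].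

(** Below, each point counted at [n] carries its own cube of side [1 / (n + c)] inside [K]. Above,
    each cube of side [1 / n] that meets [K] is translated to a point counted at [n + c]. *)
Lemma volume_sandwich : exists2 c : nat, (0 < c)%N & forall n, (0 < n)%N ->
  ((E n / (n + c)%:R ^+ N)%:E <= volume K)%E /\
  (volume K <= (E (n + c) / n%:R ^+ N)%:E)%E.
Proof.
have [c c0 [y yP]] := cube_in_dilate.
have m0 : (0 < m)%N by apply: leq_ltn_trans (ltn_ord i0).
have y1Q : dilate m Q (row_mx y1 0).
  apply/(dilate_lifting_polytope v e i0); split => // j.
  by rewrite mxE lexx (le_trans ler01).
have [u1 u1E] : exists u : 'rV[int]_N, row_mx y1 0 = m%:R *: x0 + toR u *m B.
  apply: (frame_coordinates m0) => //.
  apply/integer_pointsP => i; case: (split_ordP i) => k ->.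
    by rewrite row_mxEl; move/integer_pointsP: y1_int.
  by rewrite row_mxEr mxE.
have coord n : (0 < n)%N -> exists f : 'rV[R]_(s + p) -> 'rV[int]_N,
    forall z, subgraph n z -> z = n%:R *: x0 + toR (f z) *m B.
  move=> n0; suff /choice[f fP] : forall z, exists u : 'rV[int]_N,
      subgraph n z -> z = n%:R *: x0 + toR u *m B by exists f.
  move=> z; have [/subgraph_dilate[zQ zint]|uz] := pselect (subgraph n z); last by exists 0.
  by have [u uE] := frame_coordinates n0 zQ zint; exists u.
(* [c] makes room for the unit cube, [m] for the translation by [y1] that turns lattice points of a
   dilate of [Q] into counted ones. *)
exists (c + m)%N => [|n n0]; first by rewrite addn_gt0 c0.
have nc0 : (0 < n + (c + m))%N by rewrite addn_gt0 n0.
split.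
  have [t [tu -> tP]] := subgraph_points n.
  have [f fP] := coord n n0.
  (* Adding [u1], the coordinates of [(y1, 0)], raises the dilation factor to the common
     [n + (c + m)]. *)
  rewrite -(size_map (fun z => f z + (y + u1))); apply: volume_grid_ge => //.
    rewrite map_inj_in_uniq// => z z' /tP/fP zE /tP/fP zE' /addIr ff.
    by rewrite zE zE' ff.
  move=> _ /mapP[z /tP uz ->] x xbox; rewrite /K /=.
  apply: (dilate_inv nc0).
  pose tt : 'rV[R]_N := (n + (c + m))%:R *: x - toR (f z + (y + u1)).
  have /yP ttQ i : 0 <= tt ord0 i <= 1.
    have /andP[xl xr] := xbox i; rewrite !mxE subr_ge0.
    by rewrite !mxE in xl xr; rewrite xl /= lerBlDl ltW// addrC.
  have [zQ _] := subgraph_dilate uz.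
  suff -> : (n + (c + m))%:R *: (x0 + x *m B) =
      z + (c%:R *: x0 + (toR y + tt) *m B + row_mx y1 0).
    by apply: dilate_liftD => //; apply: dilate_liftD.
  have ttE : (n + (c + m))%:R *: x = toR (f z) + (toR y + tt) + toR u1.
    by apply/rowP => i; rewrite !mxE; ring.
  rewrite {1}(fP _ uz) u1E scalerDr scalemxAl ttE !mulmxDl !natrD !scalerDl.
  move: (toR _ *m B) (toR _ *m B) (toR _ *m B) (tt *m B) (n%:R *: _) (c%:R *: _).
  by move=> *; apply/rowP => i; rewrite !mxE; ring.
have [t [tu -> tP]] := subgraph_points (n + (c + m)).
have [f fP] := coord _ nc0.
pose y2 : 'rV[int]_N := y + const_mx 1 + u1.
rewrite -(size_map (fun z => f z - y2)); apply: volume_grid_le => // x Kx.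
pose u : 'rV[int]_N := \row_i Num.floor (n%:R * x ord0 i).
have ubox : grid_box R n u x.
  by move=> i; rewrite mxE -(intrD _ _ 1) floor_itv ?num_real.
exists u => //.
(* [tt] complements the position of [n *: x] in its cube, so that [z] below has the integer
   coordinates [u + y + 1]. *)
pose tt : 'rV[R]_N := const_mx 1 - (n%:R *: x - toR u).
have /yP ttQ i : 0 <= tt ord0 i <= 1.
  have /andP[xl xr] := ubox i; rewrite !mxE in xl xr *.
  by rewrite subr_ge0 lerBlDl ltW//= lerBlDr lerDl subr_ge0.
pose z := n%:R *: (x0 + x *m B) + (c%:R *: x0 + (toR y + tt) *m B).
have zQ : dilate (n + c) Q z by apply: dilate_liftD => //; exists (x0 + x *m B).
have zE : z = (n + c)%:R *: x0 + toR (u + (y + const_mx 1)) *m B.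
  rewrite /z /tt 2!toRD.
  have -> : toR (const_mx 1) = const_mx 1 by apply/rowP => i; rewrite !mxE.
  rewrite scalerDr scalemxAl natrD scalerDl addrACA -mulmxDl; congr (_ + _ *m _).
  by apply/rowP => i; rewrite !mxE; ring.
have zint : integer_points R _ z.
  rewrite zE; apply/integer_pointsP => i; rewrite mxE; apply: rpredD.
    rewrite mxE; apply: rpredM; first exact: natr_int.
    by move/integer_pointsP: x0_int.
  by move/integer_pointsP: (uB_int (toR_int (u + (y + const_mx 1)))).
have uz := dilate_subgraph zQ zint; rewrite -addnA in uz.
apply/mapP; exists (z + row_mx y1 0); first exact/tP.
apply: (addIr y2); rewrite subrK; apply: (@frame_inj ((n + (c + m))%:R *: x0)).
rewrite -(fP _ uz) zE u1E addnA [in LHS]natrD scalerDl [RHS]addrACA -mulmxDl -toRD.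
by rewrite /y2 addrA.
Qed.

End Sandwich.

(** * Degree and leading coefficient *)

Lemma lead_coef_ge0 (R : realType) (p : {poly R}) :
  (forall n, (0 < n)%N -> 0 <= p.[n%:R]) -> 0 <= lead_coef p.
Proof.
move=> p0; rewrite leNgt; apply/negP => lp.
have : 0 < lead_coef (- p) by rewrite lead_coefN oppr_gt0.
move=> /polyrcf.poly_pinfty_gt_lc[y yP].
have := yP (Num.truncn y).+1%:R (ltW (truncnS_gt y)).
rewrite hornerN lead_coefN lerN2 => py.
by have := le_lt_trans py lp; rewrite ltNge p0.
Qed.

(** The differences [u - q] and [q \Po X - b] are nonnegative at positive integers, so their leading
    coefficients are too; the translation in [q \Po X] keeps the degree and leading coefficient of
    [q]. A smaller degree of [q] contradicts the second difference, a larger one forces a zero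
    leading coefficient, and at degree [N] the coefficients compare both ways. *)
Lemma sandwich_lead_coef (R : realType) (q : {poly R}) (r : R) (N c : nat) :
  0 < r -> (forall n, (0 < n)%N ->
    q.[n%:R] <= r * (n + c)%:R ^+ N /\ r * n%:R ^+ N <= q.[(n + c)%:R]) ->
  size q = N.+1 /\ lead_coef q = r.
Proof.
move=> r0 qP.
pose X : {poly R} := 'X + c%:R%:P.
have sX : size X = 2 by rewrite size_XaddC.
have lX : lead_coef X = 1 by rewrite lead_coefXaddC.
pose u := r *: X ^+ N; pose b := r *: 'X^N : {poly R}.
have su : size u = N.+1.
  rewrite size_scale ?gt_eqF// -[size _]prednK ?size_exp ?sX ?mul1n//.
  by rewrite size_poly_gt0 expf_neq0// -size_poly_gt0 sX.
have lu : lead_coef u = r by rewrite lead_coefZ lead_coef_exp lX expr1n mulr1.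
have sb : size b = N.+1 by rewrite size_scale ?gt_eqF// size_polyXn.
have lb : lead_coef b = r by rewrite lead_coefZ lead_coefXn mulr1.
have sqX : size (q \Po X) = size q by rewrite size_comp_poly2.
have lqX : lead_coef (q \Po X) = lead_coef q.
  by rewrite lead_coef_comp ?sX// lX expr1n mulr1.
have up : 0 <= lead_coef (u - q).
  apply: lead_coef_ge0 => n /qP[+ _]; rewrite -subr_ge0 hornerD hornerN hornerZ.
  by rewrite horner_exp hornerD hornerX hornerC -natrD.
have lo : 0 <= lead_coef (q \Po X - b).
  apply: lead_coef_ge0 => n /qP[_]; rewrite -subr_ge0 hornerD hornerN hornerZ.
  by rewrite horner_comp hornerXn hornerD hornerX hornerC -natrD.
case: (ltngtP (size q) N.+1) => sq.
- move: lo; rewrite lead_coefDr ?size_polyN ?sb ?sqX// lead_coefN lb.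
  by rewrite oppr_ge0 leNgt r0.
- move: lo; rewrite lead_coefDl ?size_polyN ?sb ?sqX// lqX.
  move: up; rewrite lead_coefDr ?size_polyN ?su// lead_coefN oppr_ge0 => l0 l0'.
  have /eqP : lead_coef q == 0 by rewrite eq_le l0.
  by move/eqP; rewrite lead_coef_eq0 => /eqP q0; rewrite q0 size_poly0 in sq.
(* If the leading terms of a difference cancel, its coefficient of degree [N] is [0]; otherwise it
   is the leading one. *)
have coef_ge0 (f : {poly R}) : 0 <= lead_coef f -> (size f <= N.+1)%N -> 0 <= f`_N.
  move=> lf; rewrite leq_eqVlt ltnS => /predU1P[sf|sf]; last by rewrite nth_default.
  by move: lf; rewrite lead_coefE sf.
have qN : q`_N = lead_coef q by rewrite lead_coefE sq.
split=> //; apply/eqP; rewrite eq_le -subr_ge0 -[X in _ && X]subr_ge0.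
apply/andP; split.
  rewrite -lu -qN [lead_coef u]lead_coefE su -coefB; apply: coef_ge0 => //.
  by rewrite (leq_trans (size_polyD _ _))// size_polyN su sq maxnn.
rewrite -lb -lqX ![lead_coef _]lead_coefE sqX sq sb -coefB; apply: coef_ge0 => //.
by rewrite (leq_trans (size_polyD _ _))// size_polyN sb sqX sq maxnn.
Qed.

Theorem proposition5p1 (R : realType) (s m p : nat)
    (v : 'I_m -> 'rV[nat]_s) (w : 'I_p -> 'rV[R]_s -> R)
    (hp : (0 < p)%N)
    (hw : forall j, exists i : 'I_s, w j = coordinate i)
    (hw0 : forall j, exists2 x, polytope R v x & w j x != 0) :
  exists q : {poly R},
    [/\ forall n : nat, weighted_ehrhart (polytope R v) w n = q.[n%:R],
        (lead_coef q)%:E = relative_volume (lifting_polytope v w) &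
        size q = (affine_dim (polytope R v) + p).+1].
Proof.
have /choice[e wE] := hw.
have {}wE : w = fun j => coordinate (e j) by apply/funext.
subst w.
(* As [p >= 1], there is a weight; the point where it is nonzero shows that the polytope is
   nonempty. *)
have m0 : (0 < m)%N.
  have [x [k [y [c [yP _ c1 _]]]] _] := hw0 (Ordinal hp).
  case: k y c yP c1 => [|k] y c yP c1; last first.
    by have [i _ _] := yP ord0; exact: leq_ltn_trans (ltn_ord i).
  by move/eqP: c1; rewrite big_ord0 eq_sym oner_eq0.
pose i0 := Ordinal m0.
have V_neq0 j : exists i, vertex_mx R v i (e j) != 0.
  have [x Px xj] := hw0 j.
  have [y [_ _ xE]] := (dilate_polytope v i0 1 x).1 (ex_intro2 _ _ x Px (scale1r x)).
  apply/existsP; apply: contraNT xj; rewrite negb_exists => /forallP V0.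
  rewrite /coordinate xE mxE big1// => i _.
  by have := V0 i; rewrite negbK => /eqP ->; rewrite mulr0.
have [q qE] := polyfun_weighted_ehrhart R v e hp i0.
have [d [x0 [B PB]]] := polytope_lattice_frame R v i0.
have dE : affine_dim (polytope R v) = d by case: PB => Bf affP _; exact: affine_dimE affP.
have V_int := lifting_lattice_frame V_neq0 PB.
set Q := lifting_polytope _ _ in V_int *.
(* [get] returns the volume in some unspecified frame. The product frame shows that a frame exists,
   and the sandwich holds in whichever one is returned. *)
have [N [x1 [B1 [frame ->]]]] : exists N (x1 : 'rV[R]_(s + p)) (B1 : 'M[R]_(N, s + p)),
    lattice_frame Q x1 B1 /\
    relative_volume Q = volume [set u : 'rV[R]_N | Q (x1 + u *m B1)].
  rewrite /relative_volume; set D := (X in get X).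
  suff /getPex[N [x1 [B1 [frame r]]]] : exists r, D r by exists N, x1, B1.
  by eexists; exists (d + p)%N; do 2 eexists; split; first exact: V_int.
have NE : N = (d + p)%N.
  have [f1 a1 _] := frame; have [f2 a2 _] := V_int.
  by apply: (affine_image_dim f1 f2); exact: etrans (esym a1) a2.
have [c c0 sandwich] := volume_sandwich i0 V_neq0 frame.
set vol := volume _ in sandwich *.
(* The sandwich at [n = 1] puts the volume between two real numbers. *)
have [r volE] : exists r, vol = r%:E.
  have [l u] := sandwich 1%N isT; exists (fine vol); rewrite fineK//.
  by rewrite fin_numE; apply/andP; split; [move: l|move: u]; case: (vol).
have E0 : 0 < weighted_ehrhart (polytope R v) (fun j => coordinate (e j)) m.
  exact: weighted_ehrhart_gt0.
have r0 : 0 < r.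
  have [l _] := sandwich m m0; move: l; rewrite volE lee_fin; apply: lt_le_trans.
  by rewrite divr_gt0// exprn_gt0// ltr0n addn_gt0 m0.
have [|sq lq] := @sandwich_lead_coef _ q r N c r0.
  move=> n n0; have [] := sandwich n n0; rewrite volE !lee_fin !qE.
  rewrite ler_pdivrMr ?exprn_gt0 ?ltr0n ?addn_gt0 ?n0//.
  by rewrite ler_pdivlMr ?exprn_gt0 ?ltr0n.
by exists q; split; rewrite ?lq ?dE ?sq ?NE.
Qed.
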